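(* Let $A=\{-1,+1\}$ and let $g\in\mathcal G$ be attractive. Then there exist multiple (at least two distinct) $g$-measures if and only if there exist two sequences $(g_j)_{j\ge0}$ and $(g'_j)_{j\ge0}$ of functions in $\mathcal M$, both converging to $g$ in $\mathcal C(\mathcal X)$, such that the associated (unique) $g_j$-measures $\mu_j$ and $g'_j$-measures $\mu'_j$ satisfy, for some integer $k\ge0$, $$\sum_{j\ge k}\bar d(\mu_j,\mu_{j+1})+\sum_{j\ge k}\bar d(\mu'_j,\mu'_{j+1})<\bar d(\mu_k,\mu'_k).$$
   Context: Let $A=\{-1,+1\}$ with its usual order and $\mathcal X=A^{\mathbb Z_-}$, where $\mathbb Z_-=\{\ldots,-2,-1,0\}$, with the product topology (compact metrizable) and Borel $\sigma$-algebra. $\mathcal C(\mathcal X)$ is the space of continuous real functions on $\mathcal X$ with the sup norm. For $a\in A$ and $x\in\mathcal X$, the concatenation $ax\in\mathcal X$ is defined by $(ax)_0=a$ and $(ax)_{-i-1}=x_{-i}$ for $i\ge0$. The shift $T:\mathcal X\to\mathcal X$ is $(Tx)_i=x_{i-1}$. $\mathcal G$ (the regular functions) is the set of $g\in\mathcal C(\mathcal X)$ with $g(x)\in(0,1)$ and $\sum_{a\in A}g(ax)=1$ for all $x\in\mathcal X$. $\mathcal X$ carries the partial order $x\ge y\Leftrightarrow x_i\ge y_i$ for all $i\in\mathbb Z_-$. A function $g\in\mathcal G$ is attractive if for every $a\in A$ the map $x\mapsto\sum_{b\ge a}g(bx)$ is increasing (i.e. non-decreasing) on $\mathcal X$. For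 $k\ge0$, $\mathcal M_k\subset\mathcal G$ is the set of regular $k$-th order Markov kernels, i.e. those $g\in\mathcal G$ for which $g(x)$ depends only on $x_0,x_{-1},\ldots,x_{-k}$; $\mathcal M=\bigcup_{k\ge0}\mathcal M_k$. For $g\in\mathcal G$, a $g$-measure is a $T$-invariant Borel probability measure $\mu$ on $\mathcal X$ such that $\mu(\{x\in\mathcal X: x_0=a\}\mid T^{-1}\mathcal B)(x)=g(ax_{-\infty}^{-1})$ for $a\in A$ ($\mu$-a.s.), where $\mathcal B$ is the Borel $\sigma$-algebra; equivalently $\int f\,d\mu=\int\sum_{a\in A}g(ax)f(ax)\,d\mu(x)$ for all $f\in\mathcal C(\mathcal X)$. Each $g\in\mathcal M$ has a unique $g$-measure. For $T$-invariant probability measures $\mu,\mu'$ on $\mathcal X$, let $C(\mu,\mu')$ be the set of $T\otimes T$-invariant probability measures $\nu$ on $\mathcal X\times\mathcal X$ with first marginal $\mu$ and second marginal $\mu'$. Ornstein's $\bar d$-distance is $\bar d(\mu,\mu')=\inf_{\nu\in C(\mu,\mu')}\nu(\{(x,x'):x_0\ne x'_0\})$. *)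

(* Defs.v *)
From HB Require Import structures.
From mathcomp Require Export all_boot all_order all_algebra.
From mathcomp Require Export all_classical all_reals all_analysis.
Export Order.TTheory GRing.Theory Num.Theory numFieldNormedType.Exports.

Set Implicit Arguments.
Unset Strict Implicit.
Unset Printing Implicit Defensive.

Local Open Scope classical_set_scope.
Local Open Scope ring_scope.

(* The alphabet {-1 < +1} is [bool], with [false] for -1 and [true] for +1; its
   library order is [false < true] and its library topology is discrete.
   A point x of A^(Z_-) is a function on [nat] whose n-th value is x_(-n). *)
Definition past : Type := prod_topology (fun _ : nat => bool).

HB.instance Definition _ := Pointed.on past.
HB.instance Definition _ := Uniform.on past.

HB.instance Definition _ := @isMeasurable.Build
  (sigma_display (@open past)) past <<s @open past >>
  (@sigma_algebra0 _ setT (@open past)) (@sigma_algebraC past (@open past))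
  (@sigma_algebra_bigcup _ setT (@open past)).

Definition concat (a : bool) (x : past) : past :=
  fun n => if n is m.+1 then x m else a.

(* (Tx)_i = x_(i-1), that is (Tx)_(-n) = x_(-(n+1)) *)
Definition shift (x : past) : past := fun n => x n.+1.

Definition shift2 (p : past * past) : past * past := (shift p.1, shift p.2).

Definition regular (R : realType) (g : past -> R) : Prop :=
  [/\ continuous g,
      forall x, 0 < g x < 1 &
      forall x, \sum_(a : bool) g (concat a x) = 1].

Definition past_le (x y : past) : Prop := forall n, (x n <= y n)%O.

Definition attractive (R : realType) (g : past -> R) : Prop :=
  forall (a : bool) (x y : past), past_le x y ->
    \sum_(b : bool | (a <= b)%O) g (concat b x) <=
    \sum_(b : bool | (a <= b)%O) g (concat b y).

(* M_k: g(x) depends only on the k+1 symbols x_0, ..., x_(-k) *)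
Definition markov_kernel (R : realType) (k : nat) (g : past -> R) : Prop :=
  regular g /\
  forall x y : past, (forall i, (i <= k)%N -> x i = y i) -> g x = g y.

Definition some_markov_kernel (R : realType) (g : past -> R) : Prop :=
  exists k, markov_kernel k g.

(* Measures are total set functions in the library, so equality of two measures
   is only tested on measurable sets, here and in [coupling]. *)
Definition invariant d (T : measurableType d) (R : realType) (f : T -> T)
    (mu : probability T R) : Prop :=
  forall B : set T, measurable B -> mu (f @^-1` B) = mu B.

Definition same_measure d (T : measurableType d) (R : realType)
    (mu mu' : probability T R) : Prop :=
  forall B : set T, measurable B -> mu B = mu' B.

(* h is a version of the conditional probability mu(E | F) for a
   sub-sigma-algebra F *)
Definition cond_prob d (T : measurableType d) (R : realType)
    (mu : probability T R) (E : set T) (F : set (set T)) (h : T -> R) : Prop :=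
  [/\ forall B : set R, measurable B -> F (h @^-1` B),
      mu.-integrable setT (EFin \o h) &
      forall B : set T, F B -> (\int[mu]_(x in B) (h x)%:E = mu (E `&` B))%E].

(* x |-> g (concat a (shift x)) is x |-> g(a x_(-oo)^(-1)): the symbol x_0 is
   replaced by a *)
Definition g_measure (R : realType) (g : past -> R) (mu : probability past R) :
    Prop :=
  invariant shift mu /\
  forall a : bool,
    cond_prob mu [set x : past | x 0%N = a]
      [set shift @^-1` B | B in (measurable : set (set past))]
      (fun x => g (concat a (shift x))).

(* [past * past] carries the product sigma-algebra, which is the Borel one
   because [past] is second countable. *)
Definition coupling (R : realType) (mu mu' : probability past R)
    (nu : probability (past * past)%type R) : Prop :=
  [/\ invariant shift2 nu,
      forall B : set past, measurable B -> nu (fst @^-1` B) = mu B &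
      forall B : set past, measurable B -> nu (snd @^-1` B) = mu' B].

Definition dbar (R : realType) (mu mu' : probability past R) : \bar R :=
  ereal_inf [set nu [set p : past * past | p.1 0%N <> p.2 0%N]
            | nu in coupling mu mu'].

(* Main.v *)
From HB Require Import structures.
Require Import Defs.
From mathcomp Require Import ring lra zify measurable_realfun.

(** The theorem compares two one-sided approximations of g. Fix the symbols of
    the past beyond the last j + 1 ones to +1, respectively to -1: this gives
    Markov kernels that converge uniformly to g and, because g is attractive,
    lie above, respectively below, g, monotonically in j. All g-measures are
    caught between the measures of the two approximations.

    From multiplicity to the inequality. Let A_j and B_j be the probabilities of
    the symbol +1 under the upper and the lower approximation. Consecutive
    approximations admit a stationary coupling that is supported on ordered
    pairs ([monotone_coupling]); under such a coupling the probability of a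
    disagreement is a difference of probabilities of +1, so the two series of
    distances telescope and are at most A_0 - lim A_j and lim B_j - B_0, while
    the distance of the two initial measures is at least A_0 - B_0. The
    inequality therefore holds as soon as A_j - B_j stays away from 0, and it
    does: an ordered coupling bounds the difference of the two measures on an
    increasing event of n symbols by n (A_j - B_j), and increasing events
    determine a measure, so that otherwise all g-measures would coincide
    ([g_measure_unique]).

    From the inequality to multiplicity. If there were a single g-measure, both
    sequences of measures would converge to it weakly ([glim_g_measure]). Weak
    convergence does not make the distances tend to 0, but it does so for blocks
    of a fixed length n: at a late index N the blocks of the two measures are
    close in total variation. Couplings of blocks can be composed by a finite
    gluing ([transport_trans]); a chain from k up to N along the first sequence
    and back down along the second one couples blocks of the two initial
    measures at a cost per symbol bounded by the two series, up to an error.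
    Averaging such block couplings over the shifts and letting n tend to
    infinity gives a stationary coupling with the same bound
    ([transport_dbar]), against the strict inequality.

    All limits of measures are taken at the level of means, that is positive
    normalized linear functionals on all bounded functions, along one
    ultrafilter: no subsequence has to be extracted, and integrands need not be
    measurable. A mean is turned into a probability measure with the same values
    on cylinders by transporting the Lebesgue measure of the unit interval
    ([mean_measure]), and g-measures are recognized on cylinders alone
    ([g_measure_ratios] and [ratios_g_measure]). *)

Local Open Scope classical_set_scope.
Local Open Scope ring_scope.
Set Implicit Arguments.
Unset Strict Implicit.
Unset Printing Implicit Defensive.

(** * Limits along an ultrafilter, and means *)

(** An ultrafilter of index sets that contains all tails: every bounded
    sequence of reals converges along it. *)
Definition eventually_ultra : set_system nat :=
  sval (cid (@ultraFilterLemma nat \oo _)).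

#[global] Instance eventually_ultra_ultra : UltraFilter eventually_ultra.
Proof. by rewrite /eventually_ultra; case: cid => /= G []. Qed.

Lemma eventually_ultra_sub : \oo `<=` eventually_ultra.
Proof. by rewrite /eventually_ultra; case: cid => /= G []. Qed.

Definition bdd {R : realType} {E : Type} (f : E -> R) :=
  exists B, forall x, `|f x| <= B.

Section bdd.
Context {R : realType} {E : Type}.
Implicit Types f g : E -> R.

Lemma bdd_cst (c : R) : bdd (fun _ : E => c).
Proof. by exists `|c|. Qed.

Lemma bdd_bool (b : E -> bool) : bdd (fun x => (b x)%:R : R).
Proof. by exists 1 => x; case: (b x); rewrite ?normr1 ?normr0. Qed.

Lemma bddD f g : bdd f -> bdd g -> bdd (fun x => f x + g x).
Proof.
move=> [A fA] [B gB]; exists (A + B) => x.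
by rewrite (le_trans (ler_normD _ _))// lerD.
Qed.

Lemma bddM f g : bdd f -> bdd g -> bdd (fun x => f x * g x).
Proof.
by move=> [A fA] [B gB]; exists (A * B) => x; rewrite normrM ler_pM.
Qed.

Lemma bddZ c f : bdd f -> bdd (fun x => c * f x).
Proof. exact/bddM/bdd_cst. Qed.

Lemma bddN f : bdd f -> bdd (fun x => - f x).
Proof. by move=> [A fA]; exists A => x; rewrite normrN. Qed.

Lemma bddB f g : bdd f -> bdd g -> bdd (fun x => f x - g x).
Proof. by move=> fb gb; apply: bddD => //; apply: bddN. Qed.

Lemma bdd_norm f : bdd f -> bdd (fun x => `|f x|).
Proof. by move=> [A fA]; exists A => x; rewrite normr_id. Qed.

Lemma bdd_sum (I : Type) (r : seq I) (F : I -> E -> R) :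
  (forall i, bdd (F i)) -> bdd (fun x => \sum_(i <- r) F i x).
Proof.
move=> Fb; elim: r => [|i r IH].
  by have := bdd_cst 0; congr bdd; apply/funext => x; rewrite big_nil.
have := bddD (Fb i) IH.
by congr bdd; apply/funext => x; rewrite big_cons.
Qed.

End bdd.

Lemma bdd_comp {R : realType} {E E' : Type} (h : E -> E') (f : E' -> R) :
  bdd f -> bdd (fun x => f (h x)).
Proof. by move=> [A fA]; exists A => x. Qed.

Definition glim {R : realType} (u : nat -> R) : R :=
  lim (u n @[n --> eventually_ultra]).

Section glim.
Context {R : realType}.
Implicit Types u v : nat -> R.

(** The image of an ultrafilter is an ultrafilter, and a segment is compact. *)
Lemma glim_cvg u : bdd u -> u n @[n --> eventually_ultra] --> glim u.
Proof.
move=> [B uB].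
suff: cvg (u n @[n --> eventually_ultra]) by [].
pose V := u n @[n --> eventually_ultra].
have UV : UltraFilter V.
  split=> [|G PG VG]; first exact: fmap_proper_filter.
  apply/seteqP; split=> // A GA.
  have [//|] := in_ultra_setVsetC (u @^-1` A) eventually_ultra_ultra.
  rewrite preimage_setC => /VG GAc.
  have [] := @filter_not_empty _ G PG.
  by rewrite -(setICr A); exact: filterI.
have := @segment_compact R (- B) B; rewrite compact_ultra => /(_ V UV).
case; last by move=> l [_ ul]; apply/cvg_ex; exists l.
rewrite /V /nbhs /=; apply: filterE => n /=.
by rewrite in_itv /= -ler_norml.
Qed.

Lemma glim_unique u l : u n @[n --> eventually_ultra] --> l -> glim u = l.
Proof. exact: cvg_lim. Qed.

Lemma glim_lim u l : u n @[n --> \oo] --> l -> glim u = l.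
Proof.
move=> ul; apply: glim_unique; apply: cvg_trans ul.
by apply: cvg_app; exact: eventually_ultra_sub.
Qed.

Lemma glim_linear c u v : bdd u -> bdd v ->
  glim (fun n => c * u n + v n) = c * glim u + glim v.
Proof.
move=> /glim_cvg ub /glim_cvg vb; apply: glim_unique.
by apply: cvgD => //; apply: cvgM => //; exact: cvg_cst.
Qed.

Lemma glim_le u v : bdd u -> bdd v -> (\forall n \near \oo, u n <= v n) ->
  glim u <= glim v.
Proof.
move=> ub vb uv; rewrite -subr_ge0 addrC -mulN1r -glim_linear//.
apply: limr_ge; first by apply/glim_cvg/bddD => //; exact: bddZ.
apply: eventually_ultra_sub; apply: filterS uv => n.
by rewrite mulN1r addrC subr_ge0.
Qed.

Lemma glim_cst (c : R) : glim (fun=> c) = c.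
Proof. by apply: glim_lim; exact: cvg_cst. Qed.

Lemma glim_ge0 u : bdd u -> (forall n, 0 <= u n) -> 0 <= glim u.
Proof.
move=> ub u0; rewrite -[leLHS](glim_cst 0).
by apply: glim_le => //; [exact: bdd_cst|exact: nearW].
Qed.

Lemma glim_norm u : bdd u -> glim (fun n => `|u n|) = `|glim u|.
Proof. by move=> /glim_cvg uc; apply: glim_unique; apply: cvg_norm. Qed.

Lemma glim_harmonic u v c : bdd u -> bdd v ->
  (forall n, `|u n - v n| <= n.+1%:R^-1 * c) -> glim u = glim v.
Proof.
move=> ub vb uv; apply/eqP; rewrite -subr_eq0; apply/eqP.
rewrite addrC -mulN1r -glim_linear//; apply: glim_lim.
apply/norm_cvg0P; apply: (@squeeze_cvgr _ _ _ _ (fun=> 0)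
  (fun n => n.+1%:R^-1 * c)).
- by apply: nearW => n; rewrite mulN1r addrC normr_ge0 uv.
- exact: cvg_cst.
- by rewrite -(mul0r c); apply: cvgM; [exact: cvg_harmonic|exact: cvg_cst].
Qed.

End glim.

(** A finitely additive probability, seen as an integral defined on all
    bounded functions. *)
Definition is_mean {R : realType} {E : Type} (L : (E -> R) -> R) :=
  [/\ forall c f g, bdd f -> bdd g ->
        L (fun x => c * f x + g x) = c * L f + L g,
      forall f, bdd f -> (forall x, 0 <= f x) -> 0 <= L f &
      L (fun=> 1) = 1].

Section mean.
Context {R : realType} {E : Type} {L : (E -> R) -> R} (mL : is_mean L).
Implicit Types f g : E -> R.

Lemma mean0 : L (fun=> 0) = 0.
Proof.
case: mL => lin _ _; have := lin 1 _ _ (bdd_cst (0 : R)) (bdd_cst (0 : R)).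
under eq_fun do rewrite mul1r addr0.
by rewrite mul1r => /eqP; rewrite -subr_eq subrr => /eqP.
Qed.

Lemma meanZ c f : bdd f -> L (fun x => c * f x) = c * L f.
Proof.
move=> fb; case: mL => lin _ _; have := lin c _ _ fb (bdd_cst (0 : R)).
by rewrite mean0 addr0; under eq_fun do rewrite addr0.
Qed.

Lemma meanD f g : bdd f -> bdd g -> L (fun x => f x + g x) = L f + L g.
Proof.
move=> fb gb; case: mL => lin _ _; have := lin 1 _ _ fb gb.
by rewrite mul1r; under eq_fun do rewrite mul1r.
Qed.

Lemma meanN f : bdd f -> L (fun x => - f x) = - L f.
Proof.
by move=> fb; rewrite -mulN1r -meanZ//; under [in RHS]eq_fun do rewrite mulN1r.
Qed.

Lemma meanB f g : bdd f -> bdd g -> L (fun x => f x - g x) = L f - L g.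
Proof. by move=> fb gb; rewrite meanD ?meanN//; exact: bddN. Qed.

Lemma mean_cst c : L (fun=> c) = c.
Proof.
case: mL => _ _ L1; rewrite -{2}(mulr1 c) -L1 -meanZ; last exact: bdd_cst.
by under [in RHS]eq_fun do rewrite mulr1.
Qed.

Lemma mean_sum (I : Type) (r : seq I) (F : I -> E -> R) :
  (forall i, bdd (F i)) ->
  L (fun x => \sum_(i <- r) F i x) = \sum_(i <- r) L (F i).
Proof.
move=> Fb; elim: r => [|i r IH].
  by rewrite big_nil; under eq_fun do rewrite big_nil; exact: mean0.
rewrite big_cons -IH -meanD//; last exact: bdd_sum.
by under eq_fun do rewrite big_cons.
Qed.

Lemma mean_ge0 f : bdd f -> (forall x, 0 <= f x) -> 0 <= L f.
Proof. by case: mL => _ + _; apply. Qed.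

Lemma mean_le f g : bdd f -> bdd g -> (forall x, f x <= g x) -> L f <= L g.
Proof.
move=> fb gb fg; rewrite -subr_ge0 -meanB//; apply: mean_ge0.
  exact: bddB.
by move=> x; rewrite subr_ge0.
Qed.

Lemma mean_bool_ge0 (b : E -> bool) : 0 <= L (fun x => (b x)%:R).
Proof. by apply: mean_ge0 => //; exact: bdd_bool. Qed.

Lemma mean_bool_le1 (b : E -> bool) : L (fun x => (b x)%:R) <= 1.
Proof.
rewrite -[leRHS](mean_cst 1); apply: mean_le => [| |x].
- exact: bdd_bool.
- exact: bdd_cst.
- by case: (b x).
Qed.

Lemma mean_dist e f g : bdd f -> bdd g -> bdd e ->
  (forall x, `|f x - g x| <= e x) -> `|L f - L g| <= L e.
Proof.
move=> fb gb eb fge; rewrite -meanB// ler_norml -meanN//.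
apply/andP; split; apply: mean_le => //; try exact: bddN; try exact: bddB.
  by move=> x; have := fge x; rewrite ler_norml => /andP[].
by move=> x; have := fge x; rewrite ler_norml => /andP[].
Qed.

Lemma mean_bound B f : (forall x, `|f x| <= B) -> `|L f| <= B.
Proof.
move=> fB; rewrite -(subr0 (L f)) -mean0 -(mean_cst B).
apply: mean_dist => [| | |x]; [by exists B|exact: bdd_cst|exact: bdd_cst|].
by rewrite subr0.
Qed.

End mean.

Lemma mean_pullback {R : realType} {E E' : Type} (h : E -> E')
  (L : (E -> R) -> R) : is_mean L -> is_mean (fun f : E' -> R => L (fun x => f (h x))).
Proof.
move=> mL; case: (mL) => lin pos one; split=> [c f g fb gb|f fb f0|//].
  by rewrite lin//; exact: bdd_comp.
by apply: pos => //; exact: bdd_comp.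
Qed.

Lemma mean_eval {R : realType} {E : Type} (z : E) :
  is_mean (fun f : E -> R => f z).
Proof. by []. Qed.

Lemma mean_convex {R : realType} {E : Type} (I : Type) (r : seq I) (p : I -> R)
    (L : I -> (E -> R) -> R) :
  (forall i, is_mean (L i)) -> (forall i, 0 <= p i) -> \sum_(i <- r) p i = 1 ->
  is_mean (fun f => \sum_(i <- r) p i * L i f).
Proof.
move=> mL p0 p1; split=> [c f g fb gb|f fb f0|].
- rewrite mulr_sumr -big_split /=; apply: eq_bigr => i _.
  by case: (mL i) => lin _ _; rewrite lin// mulrDr mulrCA.
- by apply: sumr_ge0 => i _; rewrite mulr_ge0// (mean_ge0 (mL i)).
- rewrite -[RHS]p1; apply: eq_bigr => i _.
  by case: (mL i) => _ _ ->; rewrite mulr1.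
Qed.

Lemma mean_glim {R : realType} {E : Type} (L : nat -> (E -> R) -> R) :
  (forall n, is_mean (L n)) -> is_mean (fun f => glim (fun n => L n f)).
Proof.
move=> mL.
have Lb f : bdd f -> bdd (fun n => L n f).
  by move=> [B fB]; exists B => n; exact: mean_bound.
split=> [c f g fb gb|f fb f0|].
- rewrite -glim_linear; [|exact: Lb..].
  congr glim; apply/funext => n.
  by case: (mL n) => lin _ _; rewrite lin.
- by apply: glim_ge0; [exact: Lb|move=> n; exact: (mean_ge0 (mL n))].
- rewrite (_ : (fun n => _) = fun=> 1); last first.
    by apply/funext => n; case: (mL n).
  by apply: glim_lim; exact: cvg_cst.
Qed.

Definition markov_operator {R : realType} {E : Type} (P : (E -> R) -> E -> R) :=
  forall z, is_mean (fun f => P f z).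

Definition cesaro {R : realType} {E : Type} (P : (E -> R) -> E -> R) (z : E)
    (n : nat) (f : E -> R) : R :=
  \sum_(t < n.+1) n.+1%:R^-1 * iter t P f z.

(** A limit point of the time averages of the dynamics P started at z. *)
Definition ergodic_mean {R : realType} {E : Type} (P : (E -> R) -> E -> R)
    (z : E) (f : E -> R) : R :=
  glim (fun n => cesaro P z n f).

Section ergodic_mean.
Context {R : realType} {E : Type} {P : (E -> R) -> E -> R}.
Hypothesis mP : markov_operator P.

Lemma markov_bdd f : bdd f -> bdd (P f).
Proof.
by move=> [B fB]; exists B => x; exact: (mean_bound (mP x)).
Qed.

Lemma iter_markov_bdd t f : bdd f -> bdd (iter t P f).
Proof. by move=> fb; elim: t => //= t; exact: markov_bdd. Qed.

Lemma iter_markov_operator t : markov_operator (iter t P).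
Proof.
elim: t => [|t IH] z; first exact: mean_eval.
split=> [c f g fb gb|f fb f0|].
- rewrite iterS (_ : iter t P _ = fun x => c * iter t P f x + iter t P g x).
    by case: (mP z) => lin _ _; rewrite lin//; exact: iter_markov_bdd.
  by apply/funext => x; case: (IH x) => lin _ _; rewrite lin.
- rewrite iterS; apply: (mean_ge0 (mP z)) => [|x].
    exact: iter_markov_bdd.
  exact: (mean_ge0 (IH x)).
- rewrite iterS (_ : iter t P _ = fun=> 1); first by case: (mP z).
  by apply/funext => x; case: (IH x).
Qed.

Lemma cesaro_mean z n : is_mean (cesaro P z n).
Proof.
apply: mean_convex => [t|t|].
- exact: iter_markov_operator.
- by [].
- by rewrite sumr_const card_ord -[LHS]mulr_natr mulVf// pnatr_eq0.
Qed.

Lemma ergodic_mean_mean z : is_mean (ergodic_mean P z).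
Proof. by apply: mean_glim => n; exact: cesaro_mean. Qed.

(** The two averages differ only by their end terms. *)
Lemma cesaro_invariant B z n f : (forall x, `|f x| <= B) ->
  `|cesaro P z n (P f) - cesaro P z n f| <= n.+1%:R^-1 * (B + B).
Proof.
move=> fB; rewrite /cesaro -!mulr_sumr -mulrBr.
under eq_bigr do rewrite -iterSr.
rewrite (_ : _ - _ = iter n.+1 P f z - f z); last first.
  rewrite big_ord_recr [X in _ - X]big_ord_recl /= opprD addrACA addrC.
  by rewrite addrA addrNK.
rewrite normrM ger0_norm// ler_wpM2l//.
rewrite (le_trans (ler_normB _ _))// lerD//.
exact: (mean_bound (iter_markov_operator n.+1 z)).
Qed.

Lemma ergodic_mean_invariant z f : bdd f ->
  ergodic_mean P z (P f) = ergodic_mean P z f.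
Proof.
move=> fb; have cb h : bdd h -> bdd (fun n => cesaro P z n h).
  by move=> [B hB]; exists B => n; exact: (mean_bound (cesaro_mean z n)).
have [B fB] := fb; apply: (@glim_harmonic _ _ _ (B + B)) => [| |n].
- exact/cb/markov_bdd.
- exact: cb.
- exact: cesaro_invariant.
Qed.

End ergodic_mean.

(** * Words, cylinders and the topology of the space of pasts *)

(** Cylinders are kept as boolean functions, so that their indicators are
    integrands of means; [cyl] is the underlying set. *)
Definition cylb (w : seq bool) (x : past) : bool := mkseq x (size w) == w.

Definition cyl (w : seq bool) : set past := [set x | cylb w x].

(** A reference point of the cylinder of w. *)
Definition pad (c : bool) (w : seq bool) : past := nth c w.

Definition depends {T : Type} (n : nat) (f : past -> T) :=
  forall x y : past, mkseq x n = mkseq y n -> f x = f y.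

Lemma mkseq_shift (x : past) n : mkseq x n.+1 = x 0%N :: mkseq (shift x) n.
Proof. by rewrite /mkseq /= (iotaDl 1 0) -map_comp. Qed.

Lemma shift_concat a x : shift (concat a x) = x.
Proof. by []. Qed.

Lemma mkseq_concat a x n : mkseq (concat a x) n.+1 = a :: mkseq x n.
Proof. by rewrite mkseq_shift shift_concat. Qed.

Lemma mkseqP (x y : past) n :
  mkseq x n = mkseq y n <-> forall i, (i < n)%N -> x i = y i.
Proof.
split=> [xy i lt_in|xy]; first by rewrite -(nth_mkseq false x lt_in) xy nth_mkseq.
apply: (@eq_from_nth _ false); rewrite !size_mkseq// => i lt_in.
by rewrite !nth_mkseq// xy.
Qed.

Lemma mkseq_le (x y : past) m n :
  (m <= n)%N -> mkseq x n = mkseq y n -> mkseq x m = mkseq y m.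
Proof.
by move=> le_mn /mkseqP xy; apply/mkseqP => i /leq_trans/(_ le_mn); exact: xy.
Qed.

Lemma depends_le T m n (f : past -> T) :
  (m <= n)%N -> depends m f -> depends n f.
Proof. by move=> mn df x y /(mkseq_le mn); exact: df. Qed.

Lemma mkseq_pad c w : mkseq (pad c w) (size w) = w.
Proof. exact: mkseq_nth. Qed.

Lemma pad_cons c a w : pad c (a :: w) = concat a (pad c w).
Proof. by apply/funext => -[]. Qed.

Lemma cylb_pad c w : cylb w (pad c w).
Proof. by rewrite /cylb mkseq_pad. Qed.

Lemma cylb_rcons w a x : cylb (rcons w a) x = cylb w x && (x (size w) == a).
Proof. by rewrite /cylb size_rcons mkseqS eqseq_rcons. Qed.

Lemma cylb_cons a w x : cylb (a :: w) x = (x 0%N == a) && cylb w (shift x).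
Proof. by rewrite /cylb mkseq_shift. Qed.

Lemma cylb_concat a b w x : cylb (a :: w) (concat b x) = (b == a) && cylb w x.
Proof. by rewrite cylb_cons. Qed.

Lemma cylb_mkseq n x y : cylb (mkseq x n) y = (mkseq y n == mkseq x n).
Proof. by rewrite /cylb size_mkseq. Qed.

Lemma cylb_depends T n (f : past -> T) w x : (n <= size w)%N -> depends n f ->
  cylb w x -> f x = f (pad true w).
Proof. by move=> nw df /eqP xw; apply: df; apply: (mkseq_le nw); rewrite mkseq_pad. Qed.

Lemma depends_cylb w : depends (size w) (cylb w).
Proof. by move=> x y xy; rewrite /cylb xy. Qed.

Lemma depends_coord i : depends i.+1 (fun x : past => x i).
Proof. by move=> x y /mkseqP; exact. Qed.

(** If no cylinder at x fits into U, choosing a point outside U in each of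
    them gives a sequence that converges to x coordinatewise. *)
Lemma nbhs_pastP (x : past) (U : set past) :
  nbhs x U <-> exists n, forall y, mkseq y n = mkseq x n -> U y.
Proof.
split=> [xU|[n nU]].
- apply: contrapT => noU.
  have /choice[y yP] n : exists y : past, mkseq y n = mkseq x n /\ ~ U y.
    apply: contrapT => yU; apply: noU; exists n => z zx.
    by apply: contrapT => Uz; apply: yU; exists z.
  have yx : y n @[n --> \oo] --> x.
    apply/cvg_sup => i A; rewrite nbhsE => -[B [[C oC <-] /= Cx] CA].
    exists i.+1 => // n /= lt_in; apply: CA => /=.
    have [/mkseqP yxn _] := yP n.
    by rewrite yxn.
  have [n _ /(_ n)] := yx _ xU.
  by move=> /(_ (leqnn n)) /=; case: (yP n).
- apply: filterS (nU) _ => {U nU}.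
  elim: n => [|n IH]; first exact: filterE.
  have xn : nbhs x [set y : past | y n = x n].
    have xn : nbhs (x n) [set x n].
      by apply: open_nbhs_nbhs; split => //; exact: discrete_open.
    exact: (@proj_continuous nat (fun=> bool) n x _ xn).
  by apply: filterS2 IH xn => y /= yx yn; rewrite !mkseqS yx yn.
Qed.

Lemma open_pastP (U : set past) : open U <->
  forall x, U x -> exists n, forall y, mkseq y n = mkseq x n -> U y.
Proof.
rewrite openE; split=> oU x Ux; first exact/nbhs_pastP/oU.
exact/nbhs_pastP/oU.
Qed.

Lemma open_depends n (b : past -> bool) : depends n b -> open [set x | b x].
Proof.
by move=> db; apply/open_pastP => x /= bx; exists n => y yx; rewrite /= (db y x).
Qed.

Lemma continuous_pastP {R : realType} (g : past -> R) : continuous g <->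
  forall x e, 0 < e -> exists n, forall y, mkseq y n = mkseq x n ->
    `|g y - g x| < e.
Proof.
split=> [cg x e e0|cg x].
- have /cvgrPdist_lt/(_ _ e0)/nbhs_pastP[n ng] := cg x.
  by exists n => y /ng /=; rewrite distrC.
- apply/cvgrPdist_lt => e e0; apply/nbhs_pastP; have [n ng] := cg x e e0.
  by exists n => y /ng /=; rewrite distrC.
Qed.

(** Compactness enters through the ultrafilter: pairs that agree on longer and
    longer words while their images stay apart have a common limit, symbol by
    symbol, at which continuity fails. *)
Lemma continuous_past_unif {R : realType} (g : past -> R) : continuous g ->
  forall e, 0 < e -> exists n, forall x y, mkseq x n = mkseq y n ->
    `|g x - g y| < e.
Proof.
move=> /continuous_pastP cg e e0; apply: contrapT => noU.
have /choice[z zP] n : exists z : past * past,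
    mkseq z.1 n = mkseq z.2 n /\ ~ `|g z.1 - g z.2| < e.
  apply: contrapT => zU; apply: noU; exists n => x y xy.
  by apply: contrapT => gxy; apply: zU; exists (x, y).
pose U := eventually_ultra.
pose l : past := fun i => `[< U [set n | (z n).1 i] >].
have lU i : U [set n | (z n).1 i = l i].
  rewrite /l; case: asboolP => // nU.
  have [//|] := in_ultra_setVsetC [set n | (z n).1 i] eventually_ultra_ultra.
  by apply: filterS => n /= /negP/negbTE.
have lUn m : U [set n | mkseq (z n).1 m = mkseq l m].
  elim: m => [|m IH]; first exact: filterE.
  by apply: filterS2 IH (lU m) => n /= zl zm; rewrite !mkseqS zl zm.
have [m gm] := cg l _ (divr_gt0 e0 (ltr0n _ 2)).
have Um : U [set n | (m <= n)%N].
  by apply: eventually_ultra_sub; exists m.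
have [n [/= zl mn]] := filter_ex (filterI (lUn m) Um).
have [zn []] := zP n.
have := gm _ zl.
have zl2 : mkseq (z n).2 m = mkseq l m by rewrite -zl (mkseq_le mn zn).
have := gm _ zl2.
rewrite !ltr_norml => /andP[? ?] /andP[? ?]; apply/andP; split; lra.
Qed.

Definition cylinders : set (set past) :=
  [set A | A = set0 \/ exists w, A = cyl w].

Lemma measurable_depends n (b : past -> bool) :
  depends n b -> measurable [set x | b x].
Proof. by move=> db; apply: sub_sigma_algebra; exact: open_depends db. Qed.

Lemma measurable_cyl w : measurable (cyl w).
Proof. exact: measurable_depends (@depends_cylb w). Qed.

(** An open set is the union of the cylinders that it contains, and there are
    countably many words. *)
Lemma measurable_pastE : (measurable : set (set past)) = <<s cylinders >>.
Proof.
apply/seteqP; split.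
- apply: smallest_sub; first exact: smallest_sigma_algebra.
  move=> U /open_pastP oU.
  have -> : U = \bigcup_k (if unpickle k is Some w
      then if `[< cyl w `<=` U >] then cyl w else set0 else set0).
    apply/seteqP; split=> [x Ux|x [k _]].
      have [n nU] := oU _ Ux; exists (pickle (mkseq x n)) => //.
      rewrite pickleK; case: asboolP => [_|[]].
        by rewrite /cyl /= cylb_mkseq.
      by move=> y; rewrite /cyl /= cylb_mkseq => /eqP; exact: nU.
    by set o := unpickle k; case: o => // w; case: asboolP => // + xw; exact.
  apply: sigma_algebra_bigcup => k; apply: sub_sigma_algebra.
  by rewrite /=; case: ifP => _; [right; eexists|left].
- apply: smallest_sub; first exact: sigma_algebra_measurable.
  by move=> _ [->|[w ->]]; [exact: measurable0|exact: measurable_cyl].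
Qed.

Lemma cylindersI : setI_closed cylinders.
Proof.
suff H v w : (size v <= size w)%N -> cylinders (cyl v `&` cyl w).
  move=> _ _ [->|[v ->]] [->|[w ->]]; rewrite ?set0I ?setI0; [by left..|].
  by have [/H//|/ltnW/H] := leqP (size v) (size w); rewrite setIC.
move=> vw; have [y|noy] := pselect (exists y, (cyl v `&` cyl w) y).
  right; exists w; apply/seteqP; split=> [x []//|x xw]; split=> //.
  case: y => y [/eqP yv /eqP yw]; move: xw => /eqP xw.
  apply/eqP; rewrite -[RHS]yv; apply: (mkseq_le vw); first by rewrite xw yw.
by left; apply/seteqP; split=> // x vwx; apply: noy; exists x.
Qed.

Lemma measure_past_unique {R : realType} (m1 m2 : {measure set past -> \bar R}) :
  (m1 setT < +oo)%E -> (forall w, m1 (cyl w) = m2 (cyl w)) ->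
  forall B, measurable B -> m1 B = m2 B.
Proof.
have cyl0 : cyl [::] = setT by apply/seteqP.
move=> m1oo m12; apply: (@measure_unique _ _ _ cylinders (fun=> setT)).
- exact: measurable_pastE.
- exact: cylindersI.
- by move=> _; right; exists [::].
- by apply/seteqP; split=> // x _; exists 0%N.
- by move=> _ [->|[w ->]] //; rewrite !measure0.
- by [].
Qed.

Lemma measurable_fun_cyl d (T : measurableType d) (f : T -> past) :
  (forall w, measurable (f @^-1` cyl w)) -> measurable_fun setT f.
Proof.
move=> mf; apply: (measurability cylinders); first exact: measurable_pastE.
move=> _ [_ [->|[w ->]] <-]; rewrite setTI//.
by rewrite preimage_set0; exact: measurable0.
Qed.

Lemma measurable_fun_coord d (T : measurableType d) (f : T -> past) :
  (forall i, measurable [set t | f t i]) -> measurable_fun setT f.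
Proof.
move=> mf; apply: measurable_fun_cyl; elim/last_ind => [|w a IH].
  by rewrite (_ : _ @^-1` _ = setT)//; apply/seteqP.
have ma : measurable [set t | f t (size w) = a].
  case: a; first exact: mf.
  rewrite (_ : [set t | _] = ~` [set t | f t (size w)]).
    exact/measurableC/mf.
  by apply/seteqP; split=> t /=; [move=> ->|move=> /negP/negbTE].
rewrite (_ : _ @^-1` _ = f @^-1` cyl w `&` [set t | f t (size w) = a]).
  exact: measurableI.
apply/seteqP; split=> t /=; rewrite /cyl /= cylb_rcons.
  by move=> /andP[? /eqP].
by move=> [-> ->]; rewrite eqxx.
Qed.

Lemma measurable_coord i : measurable [set x : past | x i].
Proof.
apply: (@measurable_depends i.+1 (fun x : past => x i)) => x y /mkseqP; exact.
Qed.

(** * Additive functions of words *)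

(** These are the values on cylinders of finitely additive set functions. *)
Definition word_additive {R : realType} (p : seq bool -> R) :=
  forall w, p w = p (rcons w false) + p (rcons w true).

(** The error on a word is at most the sum of the errors on its long
    extensions, and these are small compared with r, which is additive too. *)
Lemma word_additive_eq {R : realType} (p q r : seq bool -> R) :
  word_additive p -> word_additive q -> word_additive r ->
  (forall e : R, 0 < e -> exists m, forall w, (m <= size w)%N ->
     `|p w - q w| <= e * r w) ->
  forall w, p w = q w.
Proof.
move=> ap aq ar pq w.
have close e : 0 < e -> `|p w - q w| <= e * r w.
  move=> e0; have [m pqm] := pq e e0.
  suff H k : forall v, (m <= size v + k)%N -> `|p v - q v| <= e * r v.
    by apply: (H m); exact: leq_addl.
  elim: k => [|k IH] v mvk; first by apply: pqm; rewrite addn0 in mvk.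
  rewrite ap aq ar mulrDr opprD addrACA (le_trans (ler_normD _ _))//.
  by rewrite lerD// IH// size_rcons addSnnS.
apply/eqP; rewrite -subr_eq0 -normr_eq0; apply/negP => /negP d0.
have dgt0 : 0 < `|p w - q w| by rewrite lt_neqAle eq_sym d0/=.
have r0 : 0 < r w by have := close 1 ltr01; rewrite mul1r; exact: lt_le_trans.
have r20 : 0 < 2 * r w by rewrite mulr_gt0.
have := close (`|p w - q w| / (2 * r w)) (divr_gt0 dgt0 r20).
have -> : `|p w - q w| / (2 * r w) * r w = `|p w - q w| / 2.
  by field; rewrite gt_eqF.
by lra.
Qed.

Lemma mean_word_additive {R : realType} (L : (past -> R) -> R) (b : past -> bool) :
  is_mean L -> word_additive (fun w => L (fun x => (b x && cylb w x)%:R)).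
Proof.
move=> mL w; rewrite -(meanD mL); [|exact: bdd_bool..].
congr L; apply/funext => x; rewrite !cylb_rcons.
by case: (b x); case: (cylb w x); case: (x (size w)); rewrite /= ?addr0 ?add0r.
Qed.

Definition prob {R : realType} d (T : measurableType d) (mu : probability T R)
  (b : T -> bool) : R := fine (mu [set x | b x]).

Lemma probE {R : realType} d (T : measurableType d) (mu : probability T R)
    (b : T -> bool) :
  measurable [set x | b x] -> mu [set x | b x] = (prob mu b)%:E.
Proof. by move=> mb; rewrite fineK// fin_num_measure. Qed.

Lemma prob_ge0 {R : realType} d (T : measurableType d) (mu : probability T R)
  (b : T -> bool) : 0 <= prob mu b.
Proof. exact/fine_ge0/measure_ge0. Qed.

Lemma prob_le1 {R : realType} d (T : measurableType d) (mu : probability T R)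
  (b : T -> bool) : measurable [set x | b x] -> prob mu b <= 1.
Proof. by move=> mb; rewrite -lee_fin -probE//; exact: probability_le1. Qed.

Lemma probU {R : realType} d (T : measurableType d) (mu : probability T R)
    (b b1 b2 : T -> bool) : measurable [set x | b1 x] ->
  measurable [set x | b2 x] -> (forall x, ~~ (b1 x && b2 x)) ->
  (forall x, b x = b1 x || b2 x) -> prob mu b = prob mu b1 + prob mu b2.
Proof.
move=> m1 m2 b12 bE.
rewrite /prob (_ : [set x | b x] = [set x | b1 x] `|` [set x | b2 x]); last first.
  by apply/seteqP; split=> x /=; rewrite bE => /orP.
rewrite measureU ?fineD ?fin_num_measure//.
by apply/seteqP; split=> // x [/= x1 x2]; have := b12 x; rewrite x1 x2.
Qed.

Lemma dependsI n m (b c : past -> bool) :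
  depends n b -> depends m c -> depends (maxn n m) (fun x => b x && c x).
Proof.
move=> db dc x y xy; rewrite (db x y) ?(dc x y)//.
  by apply: mkseq_le xy; exact: leq_maxr.
by apply: mkseq_le xy; exact: leq_maxl.
Qed.

Lemma prob_word_additive {R : realType} (mu : probability past R)
    n (b : past -> bool) : depends n b ->
  word_additive (fun w => prob mu (fun x => b x && cylb w x)).
Proof.
move=> db w; apply: probU => [||x|x].
- exact: measurable_depends (dependsI db (@depends_cylb _)).
- exact: measurable_depends (dependsI db (@depends_cylb _)).
- rewrite !cylb_rcons.
  by case: (b x); case: (cylb w x); case: (x (size w)).
- rewrite !cylb_rcons.
  by case: (b x); case: (cylb w x); case: (x (size w)).
Qed.

Lemma cyl_word_additive {R : realType} (mu : probability past R) :
  word_additive (fun w => prob mu (cylb w)).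
Proof.
exact: (prob_word_additive mu (n := 0) (b := fun=> true) (fun _ _ _ => erefl)).
Qed.

(** Inside a cylinder of length n the event is full or empty; hence both sides
    agree on the intersections with long cylinders, and they are additive. *)
Lemma prob_mean_depends {R : realType} (mu : probability past R)
    (L : (past -> R) -> R) : is_mean L ->
  (forall w, prob mu (cylb w) = L (fun x => (cylb w x)%:R)) ->
  forall n (b : past -> bool), depends n b -> prob mu b = L (fun x => (b x)%:R).
Proof.
move=> mL muL n b db.
have H := word_additive_eq (prob_word_additive mu db)
  (mean_word_additive b mL) (r := fun=> 0).
have {H} : forall w, prob mu (fun x => b x && cylb w x) =
    L (fun x => (b x && cylb w x)%:R).
  apply: H => [w|e e0]; first by rewrite addr0.
  exists n => w nw; rewrite mulr0 normr_le0 subr_eq0; apply/eqP.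
  have E : (fun x => b x && cylb w x) = fun x => b (pad true w) && cylb w x.
    apply/funext => x; case: (boolP (cylb w x)); rewrite ?andbF// => xw.
    by rewrite (cylb_depends nw db xw).
  rewrite E (_ : (fun x => (b x && cylb w x)%:R) =
     fun x => (b (pad true w) && cylb w x)%:R :> R); last first.
    by apply/funext => x; rewrite (congr1 (fun f => f x) E).
  case: (b (pad true w)); first exact: muL.
  rewrite /= (mean0 mL) /prob (_ : [set x | _] = set0) ?measure0//.
  by apply/seteqP; split.
move=> /(_ [::]); under eq_fun do rewrite andbT.
by move=> ->; under eq_fun do rewrite andbT.
Qed.

(** * Probability measures and means *)

Lemma probability_image {R : realType} d d' (T : measurableType d)
    (T' : measurableType d') (P : probability T R) (f : T -> T') :
  measurable_fun setT f ->
  exists Q : probability T' R, forall B, Q B = P (f @^-1` B).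
Proof.
move=> mf.
pose X : {mfun T >-> T'} := HB.pack f (isMeasurableFun.Build _ _ _ _ f mf).
by exists (distribution P X).
Qed.

Section unit_interval.
Context (R : realType).

Lemma measurable_unit_interval :
  measurable (`[0, 1[%classic : set (measurableTypeR R)).
Proof. by []. Qed.

Definition unit_lebesgue : set (measurableTypeR R) -> \bar R :=
  mrestr lebesgue_measure measurable_unit_interval.

HB.instance Definition _ := Measure.on unit_lebesgue.

Lemma unit_lebesgue_setT : unit_lebesgue setT = 1%E.
Proof.
rewrite /unit_lebesgue /mrestr setTI lebesgue_measure_itv /= lte_fin ltr01.
by rewrite oppr0 adde0.
Qed.

HB.instance Definition _ :=
  Measure_isProbability.Build _ _ _ unit_lebesgue unit_lebesgue_setT.

End unit_interval.

Section inverse_transform.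
Context {R : realType} (p : seq bool -> R).
Hypotheses (p_ge0 : forall w, 0 <= p w) (p_nil : p [::] = 1)
  (p_add : word_additive p).

(** The words of each length cut [0, 1[ in lexicographic order into intervals of
    lengths given by p; this is the left end of the interval of w. *)
Definition left_end (w : seq bool) : R :=
  \sum_(i < size w) (nth false w i)%:R * p (rcons (take i w) false).

Lemma left_end_rcons w b :
  left_end (rcons w b) = left_end w + b%:R * p (rcons w false).
Proof.
rewrite /left_end size_rcons big_ord_recr /= nth_rcons ltnn eqxx.
congr (_ + _ * p (rcons _ _)); last by rewrite -cats1 take_size_cat.
apply: eq_bigr => i _; rewrite nth_rcons ltn_ord.
have -> : take i (rcons w b) = take i w by rewrite -cats1 take_cat ltn_ord.
by [].
Qed.

Fixpoint address (u : R) (n : nat) : seq bool :=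
  if n is m.+1 then
    let w := address u m in rcons w (left_end w + p (rcons w false) <= u)
  else [::].

Definition address_point (u : R) : past := fun n =>
  left_end (address u n) + p (rcons (address u n) false) <= u.

Lemma mkseq_address u n : mkseq (address_point u) n = address u n.
Proof. by elim: n => //= n IH; rewrite mkseqS IH. Qed.

(** By induction on the word: its two extensions split the interval of w at
    the point to which the next symbol compares u. *)
Lemma cylb_address u w : 0 <= u < 1 ->
  cylb w (address_point u) = (left_end w <= u < left_end w + p w).
Proof.
move=> u01; elim/last_ind: w => [|w b IH].
  by rewrite /cylb /left_end big_ord0 add0r p_nil u01.
have := p_add w; have := p_ge0 (rcons w false); have := p_ge0 (rcons w true).
rewrite cylb_rcons left_end_rcons => p0 p1 pw.
have [wu|wu] := boolP (cylb w (address_point u)).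
  rewrite wu in IH; move: wu; rewrite /cylb mkseq_address => /eqP wu.
  rewrite /address_point wu /=; move/esym: IH => /andP[? ?].
  case: b; case: (leP (left_end w + p (rcons w false)) u) => ?; apply/esym => /=.
  - by apply/andP; split; lra.
  - by apply/negbTE/negP => /andP[? ?]; lra.
  - by apply/negbTE/negP => /andP[? ?]; lra.
  - by apply/andP; split; lra.
rewrite /=; apply/esym/negbTE; move: wu; rewrite IH; apply: contra.
by case: b => /= /andP[? ?]; apply/andP; split; lra.
Qed.

Lemma measurable_address_point :
  measurable_fun setT (address_point : measurableTypeR R -> past).
Proof.
apply: measurable_fun_cyl => w.
rewrite (_ : _ @^-1` _ = [set u | address u (size w) = w]); last first.
  by apply/seteqP; split=> u; rewrite /cyl /= /cylb mkseq_address => /eqP.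
elim/last_ind: w => [|w b IH].
  by rewrite (_ : [set u | _] = setT)//; apply/seteqP.
have mb : measurable [set u : measurableTypeR R |
    (left_end w + p (rcons w false) <= u) = b].
  case: b.
    rewrite (_ : [set u | _] = `[left_end w + p (rcons w false), +oo[%classic)//.
    by apply/seteqP; split=> u /=; rewrite in_itv /= andbT.
  rewrite (_ : [set u | _] = `]-oo, left_end w + p (rcons w false)[%classic)//.
  by apply/seteqP; split=> u /=; rewrite in_itv /= ltNge; [move=> ->|move=> /negbTE].
rewrite (_ : [set u | _] = [set u | address u (size w) = w] `&`
    [set u | (left_end w + p (rcons w false) <= u) = b]).
  exact: measurableI.
rewrite size_rcons; apply/seteqP; split=> u /=.
  by move=> /rcons_inj[-> ->].
by move=> [-> ->].
Qed.

(** The image of the Lebesgue measure under the map that sends u to the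
    sequence of the intervals containing u. *)
Lemma cylinder_extension : exists mu : probability past R,
  forall w, prob mu (cylb w) = p w.
Proof.
have [mu muE] := probability_image (@unit_lebesgue R) measurable_address_point.
exists mu => w; rewrite /prob.
have -> : mu [set x | cylb w x] = lebesgue_measure
    (`[left_end w, left_end w + p w[%classic : set (measurableTypeR R)).
  rewrite muE -[LHS]/(lebesgue_measure (_ `&` _)); congr lebesgue_measure.
  have lw : 0 <= left_end w /\ left_end w + p w <= 1.
    elim/last_ind: w => [|w b IH].
      by rewrite /left_end big_ord0 add0r p_nil.
    have := p_add w; have := p_ge0 (rcons w false); have := p_ge0 (rcons w true).
    rewrite left_end_rcons; case: IH => ? ? ? ? ?.
    by case: b => /=; split; lra.
  apply/seteqP; split=> u /=; rewrite !in_itv /=.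
    by move=> [wu u01]; rewrite -cylb_address.
  move=> wu; have u01 : 0 <= u < 1.
    by case: lw => ? ?; case/andP: wu => ? ?; apply/andP; split; lra.
  by split=> //; rewrite cylb_address.
rewrite lebesgue_measure_itv /= lte_fin ltrDl.
have := p_ge0 w; rewrite le_eqVlt => /orP[/eqP <-|->].
  by rewrite ltxx.
by rewrite /= addrAC subrr add0r.
Qed.

End inverse_transform.

Lemma mean_measure {R : realType} (L : (past -> R) -> R) : is_mean L ->
  exists mu : probability past R, forall n (b : past -> bool),
    depends n b -> prob mu b = L (fun x => (b x)%:R).
Proof.
move=> mL.
have [| | |mu muL] := @cylinder_extension R (fun w => L (fun x => (cylb w x)%:R)).
- by move=> w; exact: mean_bool_ge0.
- exact: (mean_cst mL).
- exact: (mean_word_additive (fun=> true)).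
by exists mu; exact: prob_mean_depends.
Qed.

Lemma sum_cylb {R : realType} n (x : past) :
  \sum_(w : n.-tuple bool) (cylb w x)%:R = 1 :> R.
Proof.
have sz : size (mkseq x n) == n by rewrite size_mkseq.
rewrite (bigD1 (Tuple sz)) //= /cylb size_mkseq eqxx big1 ?addr0// => w wx.
rewrite size_tuple; case: eqP => // E; case/eqP: wx; exact/val_inj.
Qed.

(** The mean is a limit of Riemann sums over the cylinders of length n; on a
    cylinder event the sums are eventually constant. *)
Lemma measure_mean {R : realType} (mu : probability past R) :
  exists2 L : (past -> R) -> R, is_mean L &
    forall n (b : past -> bool), depends n b ->
      prob mu b = L (fun x => (b x)%:R).
Proof.
pose L n (f : past -> R) :=
  \sum_(w : n.-tuple bool) prob mu (cylb w) * f (pad true w).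
have L_cyl n v : (size v <= n)%N ->
    L n (fun x => (cylb v x)%:R) = prob mu (cylb v).
  move=> /subnKC; move: (n - size v)%N => k; elim: k v => [|k IH] v vk.
    rewrite addn0 in vk; have sv : size v == n by rewrite vk.
    rewrite /L (bigD1 (Tuple sv)) //= cylb_pad mulr1 big1 ?addr0// => w wv.
    rewrite /cylb vk -[X in mkseq _ X](size_tuple w) mkseq_pad.
    case: eqP; rewrite ?mulr0// => E; case/eqP: wv; exact/val_inj.
  have /= -> := cyl_word_additive mu v.
  rewrite -!IH ?size_rcons ?addSnnS// -big_split /=.
  apply: eq_bigr => w _; rewrite -mulrDr !cylb_rcons; congr (_ * _).
  by case: (cylb v _); case: (pad _ _ _); rewrite /= ?addr0 ?add0r.
have mL n : is_mean (L n).
  apply: mean_convex => [w|w|]; first exact: mean_eval.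
  - exact/fine_ge0/measure_ge0.
  - have := L_cyl n [::] isT; rewrite /L /=.
    under eq_bigr do rewrite mulr1.
    move=> ->; rewrite /prob (_ : [set x | _] = setT) ?probability_setT//.
    by apply/seteqP; split.
have mM := mean_glim mL.
exists (fun f => glim (fun n => L n f)) => //.
apply: (prob_mean_depends mM) => v; apply/esym/glim_lim; apply: cvg_near_cst.
by exists (size v) => // n /= vn; exact: L_cyl.
Qed.

(** * Pairs of pasts *)

(** Interleaving two pasts identifies pairs of pasts with pasts, so that what
    was shown for measures on pasts carries over to couplings. *)
Definition interleave (q : past * past) : past :=
  fun n => if odd n then q.2 n./2 else q.1 n./2.

Definition deinterleave (x : past) : past * past :=
  (fun n => x n.*2, fun n => x n.*2.+1).

Lemma interleaveK : cancel interleave deinterleave.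
Proof.
move=> [x y]; congr (_, _); apply/funext => n; rewrite /interleave /=.
  by rewrite odd_double doubleK.
by rewrite odd_double /= uphalf_double.
Qed.

Definition depends2 {T : Type} (n : nat) (f : past * past -> T) :=
  forall q r : past * past, mkseq q.1 n = mkseq r.1 n ->
    mkseq q.2 n = mkseq r.2 n -> f q = f r.

Lemma depends2_deinterleave T n (f : past * past -> T) :
  depends2 n f -> depends n.*2 (fun x => f (deinterleave x)).
Proof.
move=> df x y /mkseqP xy; apply: df; apply/mkseqP => i lt_in /=; apply: xy.
  by rewrite ltn_double.
by rewrite -doubleS leq_double.
Qed.

Lemma depends_interleave T n (f : past -> T) :
  depends n f -> depends2 n (fun q => f (interleave q)).
Proof.
move=> df [x1 x2] [y1 y2] /= /mkseqP x1y1 /mkseqP x2y2; apply: df.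
have hn i : (i < n -> i./2 < n)%N.
  by apply: leq_ltn_trans; rewrite -{2}(odd_double_half i) -addnn addnCA leq_addr.
apply/mkseqP => i /hn lt_in; rewrite /interleave /=.
by case: ifP => _; [exact: x2y2|exact: x1y1].
Qed.

Lemma measurable_interleave : measurable_fun setT interleave.
Proof.
apply: measurable_fun_coord => i.
have mc (f : past * past -> past) j : measurable_fun setT f ->
    measurable [set q | f q j].
  by move=> /(_ measurableT _ (measurable_coord j)); rewrite setTI.
rewrite /interleave; case: (odd i).
  by apply: (mc snd); exact: measurable_snd.
by apply: (mc fst); exact: measurable_fst.
Qed.

Lemma measurable_deinterleave : measurable_fun setT deinterleave.
Proof.
by apply/measurable_fun_pairP; split; apply: measurable_fun_coord => i;
  exact: measurable_coord.
Qed.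

Lemma measurable_shift : measurable_fun setT shift.
Proof. by apply: measurable_fun_coord => i; exact: measurable_coord. Qed.

Lemma measurable_depends2 n (b : past * past -> bool) : depends2 n b ->
  measurable [set q | b q].
Proof.
move=> /depends2_deinterleave/measurable_depends mb.
have := measurable_interleave measurableT mb; rewrite setTI.
by congr measurable; apply/seteqP; split=> q /=; rewrite interleaveK.
Qed.

Lemma mean_measure2 {R : realType} (L : (past * past -> R) -> R) : is_mean L ->
  exists nu : probability (past * past)%type R,
    forall n (b : past * past -> bool), depends2 n b ->
      prob nu b = L (fun q => (b q)%:R).
Proof.
move=> mL.
have [mu muL] := mean_measure (mean_pullback interleave mL).
have [nu nuE] := probability_image mu measurable_deinterleave.
exists nu => n b db; rewrite /prob nuE.
rewrite -[LHS]/(prob mu (fun x => b (deinterleave x))).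
rewrite (muL _ _ (depends2_deinterleave db)); congr L.
by apply/funext => q; rewrite interleaveK.
Qed.

Lemma measure_mean2 {R : realType} (nu : probability (past * past)%type R) :
  exists2 L : (past * past -> R) -> R, is_mean L &
    forall n (b : past * past -> bool), depends2 n b ->
      prob nu b = L (fun q => (b q)%:R).
Proof.
have [mu muE] := probability_image nu measurable_interleave.
have [L mL muL] := measure_mean mu.
exists (fun f => L (fun x => f (deinterleave x))).
  exact: mean_pullback mL.
move=> n b db; rewrite -(muL _ _ (depends2_deinterleave db)) /prob muE /=.
by congr (fine (nu _)); apply/seteqP; split=> q /=; rewrite interleaveK.
Qed.

Lemma prob_past_unique {R : realType} (mu mu' : probability past R) :
  (forall w, prob mu (cylb w) = prob mu' (cylb w)) -> same_measure mu mu'.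
Proof.
move=> mumu' B; apply: (@measure_past_unique R mu mu') => [|w].
  have : (mu setT < +oo)%E by rewrite probability_setT ltry.
  exact.
have mw := measurable_cyl w.
have : mu (cyl w) = mu' (cyl w) by rewrite !probE ?mumu'.
exact.
Qed.

Lemma prob2_unique {R : realType} (nu nu' : probability (past * past)%type R) :
  (forall n (b : past * past -> bool), depends2 n b -> prob nu b = prob nu' b) ->
  same_measure nu nu'.
Proof.
move=> nunu' B mB.
have [mu muE] := probability_image nu measurable_interleave.
have [mu' muE'] := probability_image nu' measurable_interleave.
have BE : B = interleave @^-1` (deinterleave @^-1` B).
  by apply/seteqP; split=> q /=; rewrite interleaveK.
rewrite BE -muE -muE'; apply: prob_past_unique => [w|].
  rewrite /prob muE muE'.
  exact: nunu' (depends_interleave (@depends_cylb w)).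
by rewrite -[X in measurable X]setTI; exact: measurable_deinterleave.
Qed.

(** * g-measures in terms of cylinders *)

(** The conditional probability of a given w is nearly g. Stated on cylinders,
    the condition passes to limits of measures. *)
Definition conditional_ratios {R : realType} (g : past -> R) (p : seq bool -> R) :=
  forall e, 0 < e -> exists m, forall w, (m <= size w)%N -> forall a,
    `|p (a :: w) - g (pad true (a :: w)) * p w| <= e * p w.

Lemma continuous_concat {R : realType} (g : past -> R) a :
  continuous g -> continuous (fun x => g (concat a x)).
Proof.
move=> /continuous_pastP cg; apply/continuous_pastP => x e e0.
have [n gn] := cg (concat a x) e e0; exists n => y yx; apply: gn.
by apply: (@mkseq_le _ _ n n.+1); rewrite ?mkseq_concat ?yx.
Qed.

Lemma measurable_continuous {R : realType} (f : past -> R) :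
  continuous f -> measurable_fun setT f.
Proof.
move=> /continuousP cf; apply: (measurability _ (RGenOpens.measurableE R)).
move=> _ [_ [a [b ->] <-]]; rewrite setTI; apply: sub_sigma_algebra.
exact/cf/interval_open.
Qed.

Section regular.
Context {R : realType} (g : past -> R) (hg : regular g).

Lemma regular_ge0 x : 0 <= g x.
Proof. by case: hg => _ /(_ x) /andP[/ltW]. Qed.

Lemma regular_le1 x : g x <= 1.
Proof. by case: hg => _ /(_ x) /andP[_ /ltW]. Qed.

Lemma regular_sum x : g (concat true x) + g (concat false x) = 1.
Proof. by case: hg => _ _ gs; rewrite -(gs x) big_bool. Qed.

Lemma regular_false x : g (concat false x) = 1 - g (concat true x).
Proof. by rewrite -(regular_sum x) addrAC subrr add0r. Qed.

Lemma regular_bdd : bdd g.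
Proof.
by exists 1 => x; rewrite ger0_norm ?regular_ge0 ?regular_le1.
Qed.

Lemma regular_oscillation e : 0 < e -> exists m, forall w, (m <= size w)%N ->
  forall a x, cylb w x -> `|g (concat a x) - g (pad true (a :: w))| <= e.
Proof.
move=> e0; case: hg => cg _ _; have [m gm] := continuous_past_unif cg e0.
exists m => w mw a x /eqP xw; apply/ltW/gm; rewrite pad_cons.
apply: (@mkseq_le _ _ m (size w).+1); first exact: leqW.
by rewrite !mkseq_concat mkseq_pad xw.
Qed.

Lemma measurable_replace a :
  measurable_fun setT (fun x => g (concat a (shift x))).
Proof.
case: hg => /(@continuous_concat _ _ a)/measurable_continuous mg _ _.
exact: (measurableT_comp mg measurable_shift).
Qed.

Lemma integrable_replace (mu : probability past R) a :
  mu.-integrable setT (EFin \o (fun x => g (concat a (shift x)))).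
Proof.
apply: measurable_bounded_integrable => //.
- by rewrite [X in (X < _)%E](probability_setT mu) ltry.
- exact: measurable_replace.
- exists 1; split=> // M M1 x _ /=.
  by rewrite ger0_norm ?regular_ge0// (le_trans (regular_le1 _))// ltW.
Qed.

End regular.

Lemma integral_oscillation {R : realType} d (T : measurableType d)
    (P : probability T R) (h : T -> R) (B : set T) (c e : R) :
  P.-integrable setT (EFin \o h) -> measurable B ->
  (forall x, B x -> `|h x - c| <= e) ->
  `|fine (\int[P]_(x in B) (h x)%:E)%E - c * fine (P B)| <= e * fine (P B).
Proof.
move=> ih mB hc.
have ihB : P.-integrable B (EFin \o h) by apply: integrableS ih.
have PB : P B = (fine (P B))%:E by rewrite fineK// fin_num_measure.
have icst k : P.-integrable B (EFin \o cst k) by exact: finite_measure_integrable_cst.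
have E : (\int[P]_(x in B) (h x)%:E = (fine (\int[P]_(x in B) (h x)%:E))%:E)%E.
  by rewrite fineK// integrable_fin_num.
have bnd k : (\int[P]_(x in B) (k%:E) = (k * fine (P B))%:E)%E.
  by rewrite integral_cst// EFinM; congr (_ * _)%E; exact: PB.
have lo : ((c - e) * fine (P B) <= fine (\int[P]_(x in B) (h x)%:E)%E).
  rewrite -lee_fin -E -bnd; apply: (le_integral mB (icst _) ihB) => x /set_mem /hc.
  rewrite ler_norml => /andP[h1 _]; rewrite lee_fin.
  have : c - e <= h x by lra.
  exact.
have hi : (fine (\int[P]_(x in B) (h x)%:E)%E <= (c + e) * fine (P B)).
  rewrite -lee_fin -E -bnd; apply: (le_integral mB ihB (icst _)) => x /set_mem /hc.
  rewrite ler_norml => /andP[_ h1]; rewrite lee_fin.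
  have : h x <= c + e by lra.
  exact.
by rewrite ler_norml; apply/andP; split; lra.
Qed.

Lemma measurable_preimage_shift B : measurable B -> measurable (shift @^-1` B).
Proof. by move=> mB; rewrite -[X in measurable X]setTI; exact: measurable_shift. Qed.

Lemma first_symbol_cyl a w :
  [set x : past | x 0%N = a] `&` shift @^-1` cyl w = cyl (a :: w).
Proof.
apply/seteqP; split=> x /=; rewrite /cyl /= cylb_cons.
  by move=> [-> ->]; rewrite eqxx.
by move=> /andP[/eqP].
Qed.

Lemma measurable_first_symbol a : measurable [set x : past | x 0%N = a].
Proof.
rewrite (_ : [set x | _] = cyl [:: a]); first exact: measurable_cyl.
apply/seteqP; split=> x; rewrite /cyl /= cylb_cons andbT; first by move=> ->.
by move=> /eqP.
Qed.

(** The conditional probability of the symbol a is integrated over the points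
    whose shift lies in the cylinder of w; by invariance these have the
    measure of that cylinder. *)
Lemma g_measure_cyl {R : realType} (g : past -> R) (mu : probability past R)
    w a c e : regular g -> g_measure g mu ->
  (forall x, cylb w x -> `|g (concat a x) - c| <= e) ->
  `|prob mu (cylb (a :: w)) - c * prob mu (cylb w)| <= e * prob mu (cylb w).
Proof.
move=> hg [inv cond] gc.
have mw := measurable_cyl w.
have [_ ih /(_ (shift @^-1` cyl w)) H] := cond a.
have {}H := H (imageP _ mw); rewrite first_symbol_cyl in H.
have := @integral_oscillation R _ _ mu (fun x => g (concat a (shift x)))
  (shift @^-1` cyl w) c e ih (measurable_preimage_shift mw) (fun x xw => gc _ xw).
by rewrite inv// H.
Qed.

Lemma g_measure_ratios {R : realType} (g : past -> R) (mu : probability past R) :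
  regular g -> g_measure g mu -> conditional_ratios g (fun w => prob mu (cylb w)).
Proof.
move=> hg gmu e e0; have [m gm] := regular_oscillation hg e0.
by exists m => w mw a; apply: (g_measure_cyl hg gmu) => x; exact: gm.
Qed.

Lemma prob_shift_cyl {R : realType} (mu : probability past R) w :
  prob mu (fun x => cylb w (shift x)) =
  prob mu (cylb (true :: w)) + prob mu (cylb (false :: w)).
Proof.
apply: probU => [||x|x]; rewrite ?cylb_cons.
- exact: measurable_cyl.
- exact: measurable_cyl.
- by case: (x 0%N); case: (cylb w _).
- by case: (x 0%N); case: (cylb w _).
Qed.

Section ratios_g_measure.
Context {R : realType} (g : past -> R) (hg : regular g)
  (mu : probability past R).
Hypothesis ratios : conditional_ratios g (fun w => prob mu (cylb w)).

(** The ratios for the two symbols add up to 1, so prepending a symbol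
    preserves the measure of long cylinders up to a small relative error. *)
Lemma ratios_invariant : invariant shift mu.
Proof.
have [mus musE] := probability_image mu measurable_shift.
move=> B mB; rewrite -musE; apply: prob_past_unique mB.
have cmu := cyl_word_additive mu.
apply: (word_additive_eq (cyl_word_additive mus) cmu cmu) => e e0.
have [m gm] := ratios (divr_gt0 e0 (ltr0n _ 2)).
exists m => w mw.
have -> : prob mus (cylb w) =
    prob mu (cylb (true :: w)) + prob mu (cylb (false :: w)).
  by rewrite -prob_shift_cyl /prob musE.
have := gm w mw true; have := gm w mw false.
have := regular_sum hg (pad true w); rewrite !pad_cons => gs.
have -> : g (concat false (pad true w)) = 1 - g (concat true (pad true w)).
  by rewrite -gs; ring.
rewrite !ler_norml => /andP[? ?] /andP[? ?]; apply/andP; split; lra.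
Qed.

(** Both sides are additive in w and close to g times the measure of w for
    long w. *)
Lemma ratios_integral_cyl a w :
  (\int[mu]_(x in shift @^-1` cyl w) (g (concat a (shift x)))%:E)%E =
  mu (cyl (a :: w)).
Proof.
pose I w : R := fine (\int[mu]_(x in shift @^-1` cyl w) (g (concat a (shift x)))%:E)%E.
have ih := integrable_replace hg mu a.
have mh : measurable_fun setT (fun x : past => (g (concat a (shift x)))%:E).
  by apply/measurable_EFinP; exact: measurable_replace.
have mws w' := measurable_preimage_shift (measurable_cyl w').
have IE w' : (\int[mu]_(x in shift @^-1` cyl w') (g (concat a (shift x)))%:E)%E
    = (I w')%:E.
  rewrite fineK//; apply: integrable_fin_num => //.
  exact: integrableS ih.
rewrite IE probE; last exact: measurable_cyl.
congr (_%:E); move: w.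
apply: (word_additive_eq (r := fun w => prob mu (cylb w))).
- move=> w; apply: EFin_inj; rewrite EFinD -!IE.
  rewrite -integral_setU //=.
  + congr (integral _ _ _); rewrite -preimage_setU; congr (_ @^-1` _).
    apply/seteqP; split=> x; rewrite /cyl /= !cylb_rcons.
      by move=> ->; case: (x _); [right|left].
    by move=> [] /andP[].
  + exact: (measurable_funS measurableT _ mh).
  + rewrite disj_set2E; apply/eqP/seteqP; split=> // x [].
    by rewrite /cyl /= !cylb_rcons => /andP[_ /eqP ->] /andP[_].
- by move=> w; exact: (cyl_word_additive mu (a :: w)).
- exact: cyl_word_additive.
move=> e e0; have e20 := divr_gt0 e0 (ltr0n R 2).
have [m gm] := ratios e20; have [m' gm'] := regular_oscillation hg e20.
exists (maxn m m') => w; rewrite geq_max => /andP[mw mw'].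
have := gm w mw a.
have := @integral_oscillation R _ _ mu (fun x => g (concat a (shift x)))
  (shift @^-1` cyl w) (g (pad true (a :: w))) _ ih (mws w)
  (fun x xw => gm' w mw' a _ xw).
rewrite (ratios_invariant (measurable_cyl w)) -/(I w) -[fine _]/(prob mu (cylb w)).
rewrite !ler_norml => /andP[? ?] /andP[? ?]; apply/andP; split; lra.
Qed.

(** The identity that defines conditional probabilities extends from cylinders
    to Borel sets by a monotone class argument. *)
Lemma ratios_g_measure : g_measure g mu.
Proof.
split; first exact: ratios_invariant.
move=> a; have ih := integrable_replace hg mu a; split=> //.
  move=> B mB; exists ((fun x => g (concat a x)) @^-1` B) => //.
  rewrite -[X in measurable X]setTI.
  case: hg => cg _ _.
  exact: (measurable_continuous (continuous_concat cg)).
move=> _ [B mB <-].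
have mh : measurable_fun setT (fun x : past => (g (concat a (shift x)))%:E).
  by apply/measurable_EFinP; exact: measurable_replace.
have ma := measurable_first_symbol a.
have setTE : (\int[mu]_x (g (concat a (shift x)))%:E =
    mu [set x : past | x 0%N = a])%E.
  have := ratios_integral_cyl a [::].
  rewrite -first_symbol_cyl (_ : cyl [::] = setT); last by apply/seteqP.
  by rewrite preimage_setT setIT.
pose P := [set B | (\int[mu]_(x in shift @^-1` B) (g (concat a (shift x)))%:E
  = mu ([set x : past | x 0%N = a] `&` shift @^-1` B))%E].
suff: P B by [].
rewrite measurable_pastE in mB.
apply: (dynkin_induction measurable_pastE cylindersI) mB; rewrite /P /=.
- by rewrite preimage_setT setIT.
- move=> _ [->|[w ->]] /=; first by rewrite preimage_set0 integral_set0 setI0 measure0.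
  by rewrite ratios_integral_cyl first_symbol_cyl.
- move=> S mS SE; have mS' := measurable_preimage_shift mS.
  have mSC := measurableC mS'.
  have iS : (\int[mu]_(x in shift @^-1` S) (g (concat a (shift x)))%:E)%E
      \is a fin_num.
    by apply: integrable_fin_num => //; exact: integrableS ih.
  rewrite -[LHS](addeK _ iS) -[RHS](addeK _ iS); congr (_ - _)%E.
  rewrite addeC [RHS]addeC.
  rewrite preimage_setC -integral_setU//=.
  + rewrite setUv [RHS](_ : _ = mu [set x : past | x 0%N = a]); first exact: setTE.
    rewrite SE -measureU//.
    * by rewrite -setIUr setUv setIT.
    * exact: measurableI.
    * exact: measurableI.
    * by rewrite setIACA setICr setI0.
  + by rewrite setUv.
  + by rewrite disj_set2E setICr.
- move=> F mF tF FE; rewrite preimage_bigcup.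
  have mF' n := measurable_preimage_shift (mF n).
  have tF' : trivIset setT (fun n => shift @^-1` F n).
    apply/trivIsetP => i j _ _ ij; rewrite -preimage_setI.
    by move/trivIsetP : tF => /(_ i j I I ij) ->; rewrite preimage_set0.
  rewrite ge0_integral_bigcup//=.
  + rewrite setI_bigcupr measure_semi_bigcup//.
    * by apply: eq_eseriesr => n _; exact: FE.
    * by move=> n; exact: measurableI.
    * exact: trivIset_setIl.
    * by apply: bigcup_measurable => n _; exact: measurableI.
  + exact: (measurable_funS measurableT _ mh).
  + by move=> x _; rewrite lee_fin regular_ge0.
Qed.

End ratios_g_measure.

(** * The dynamics of a regular function *)

(** The transfer operator: the expectation of f after one step of the chain
    that prepends a symbol drawn according to g. *)
Definition ruelle {R : realType} (g : past -> R) (f : past -> R) (x : past) : R :=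
  g (concat true x) * f (concat true x) + g (concat false x) * f (concat false x).

Section ruelle.
Context {R : realType} (g : past -> R) (hg : regular g).

Lemma ruelle_markov : markov_operator (ruelle g).
Proof.
move=> x; split=> [c f f' _ _|f _ f0|]; rewrite /ruelle.
- ring.
- by rewrite addr_ge0// mulr_ge0// (regular_ge0 hg).
- by rewrite !mulr1 regular_sum.
Qed.

Lemma ruelle_bdd f : bdd f -> bdd (ruelle g f).
Proof. exact: markov_bdd ruelle_markov _. Qed.

(** Shifting undoes the prepending of a symbol. *)
Lemma ruelle_shift f : ruelle g (fun x => f (shift x)) = f.
Proof. by apply/funext => x; rewrite /ruelle /= -mulrDl regular_sum// mul1r. Qed.

Lemma ruelle_cylb a w :
  ruelle g (fun x => (cylb (a :: w) x)%:R) =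
  fun x => g (concat a x) * (cylb w x)%:R.
Proof.
apply/funext => x; rewrite /ruelle !cylb_concat.
by case: a => /=; rewrite mulr0 ?addr0 ?add0r.
Qed.

Lemma ergodic_mean_shift z f : bdd f ->
  ergodic_mean (ruelle g) z (fun x => f (shift x)) = ergodic_mean (ruelle g) z f.
Proof.
move=> fb; rewrite -(ergodic_mean_invariant ruelle_markov) ?ruelle_shift//.
exact: bdd_comp.
Qed.

Lemma ergodic_mean_coord z i :
  ergodic_mean (ruelle g) z (fun x => (x i)%:R) =
  ergodic_mean (ruelle g) z (fun x => (x 0%N)%:R).
Proof.
elim: i => // i <-.
by apply: (ergodic_mean_shift z (f := fun x => (x i)%:R)); exact: bdd_bool.
Qed.

End ruelle.

Lemma cyl_decomposition {R : realType} n (f : past -> R) : depends n f ->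
  f = fun x => \sum_(w : n.-tuple bool) f (pad true w) * (cylb w x)%:R.
Proof.
move=> df; apply/funext => x.
rewrite (eq_bigr (fun w : n.-tuple bool => f x * (cylb w x)%:R)) => [|w _].
  by rewrite -mulr_sumr sum_cylb mulr1.
case: (boolP (cylb w x)) => xw; last by rewrite !mulr0.
by rewrite (@cylb_depends _ n f w x) ?size_tuple.
Qed.

Lemma depends_bdd {R : realType} n (f : past -> R) : depends n f -> bdd f.
Proof.
move=> /cyl_decomposition ->; apply: bdd_sum => w; apply: bddZ; exact: bdd_bool.
Qed.

Lemma depends_ruelle {R : realType} n (g f : past -> R) :
  depends n g -> depends n f -> depends n (ruelle g f).
Proof.
move=> dg df x y xy.
have cxy a : mkseq (concat a x) n = mkseq (concat a y) n.
  by apply: (@mkseq_le _ _ n n.+1) => //; rewrite !mkseq_concat xy.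
by rewrite /ruelle !(dg _ _ (cxy _)) !(df _ _ (cxy _)).
Qed.

(** Reduction to cylinders aw: there the dynamics gives g(a x) times the
    indicator of w, which for long w is nearly a constant times that
    indicator, with the constant that the conditional ratios predict. *)
Lemma g_measure_ruelle {R : realType} (g : past -> R) (mu : probability past R)
    (L : (past -> R) -> R) : regular g -> g_measure g mu -> is_mean L ->
  (forall w, prob mu (cylb w) = L (fun x => (cylb w x)%:R)) ->
  forall n f, depends n f -> L (ruelle g f) = L f.
Proof.
move=> hg gmu mL muL.
have gb a : bdd (fun x => g (concat a x)) := bdd_comp _ (regular_bdd hg).
have gcb a w : bdd (fun x => g (concat a x) * (cylb w x)%:R).
  by apply: bddM => //; exact: bdd_bool.
have Lcyl a w : L (fun x => g (concat a x) * (cylb w x)%:R) =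
    prob mu (cylb (a :: w)).
  move: w; apply: (word_additive_eq (r := fun w => prob mu (cylb w))).
  - move=> w; rewrite -(meanD mL)//; congr L; apply/funext => x.
    rewrite !cylb_rcons -mulrDr; congr (_ * _).
    by case: (cylb w x); case: (x _); rewrite /= ?addr0 ?add0r.
  - by move=> w; exact: (cyl_word_additive mu (a :: w)).
  - exact: cyl_word_additive.
  move=> e e0; have e20 := divr_gt0 e0 (ltr0n R 2).
  have [m gm] := g_measure_ratios hg gmu e20.
  have [m' gm'] := regular_oscillation hg e20.
  exists (maxn m m') => w; rewrite geq_max => /andP[mw mw'].
  have := gm w mw a.
  have : `|L (fun x => g (concat a x) * (cylb w x)%:R) -
      L (fun x => g (pad true (a :: w)) * (cylb w x)%:R)| <=
      L (fun x => e / 2 * (cylb w x)%:R).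
    apply: (mean_dist mL) => // [| |x]; [apply: bddZ; exact: bdd_bool..|].
    case: (boolP (cylb w x)) => xw; last by rewrite !mulr0 subrr normr0.
    by rewrite !mulr1; exact: gm'.
  rewrite !(meanZ mL) -?muL; [|exact: bdd_bool..].
  rewrite !ler_norml => /andP[? ?] /andP[? ?]; apply/andP; split; lra.
move=> n f df.
have {}df := cyl_decomposition (depends_le (leqnSn n) df).
have fE : ruelle g f = fun x => \sum_(w : n.+1.-tuple bool)
    f (pad true w) * ruelle g (fun x => (cylb w x)%:R) x.
  apply/funext => x; rewrite [in LHS]df {1}/ruelle.
  rewrite !mulr_sumr -big_split /=; apply: eq_bigr => w _.
  by rewrite /ruelle; ring.
rewrite fE [in RHS]df !(mean_sum mL); first last.
- by move=> w; apply: bddZ; apply: (ruelle_bdd hg); exact: bdd_bool.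
- by move=> w; apply: bddZ; exact: bdd_bool.
apply: eq_bigr => w _; rewrite !(meanZ mL); first last.
- exact: (ruelle_bdd hg (bdd_bool _)).
- exact: bdd_bool.
have [a [v ->]] : exists a v, (w : seq bool) = a :: v.
  by case/tupleP: w => a v; exists a, v.
by rewrite ruelle_cylb Lcyl muL.
Qed.

(** A Markov kernel is constant on long cylinders, so the invariance of the
    time averages under the dynamics gives the conditional ratios exactly. *)
Lemma ergodic_g_measure {R : realType} k (h : past -> R) z
    (mu : probability past R) : regular h -> depends k h ->
  (forall w, prob mu (cylb w) =
     ergodic_mean (ruelle h) z (fun x => (cylb w x)%:R)) ->
  g_measure h mu.
Proof.
move=> hh dh muE; apply: ratios_g_measure => // e e0.
have mM := ergodic_mean_mean (ruelle_markov hh) z.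
exists k => w kw a.
rewrite [X in X - _]muE -(ergodic_mean_invariant (ruelle_markov hh)); last first.
  exact: bdd_bool.
rewrite ruelle_cylb (_ : (fun x => _) =
    fun x => h (pad true (a :: w)) * (cylb w x)%:R); last first.
  apply/funext => x; case: (boolP (cylb w x)) => xw; last by rewrite !mulr0.
  rewrite (@cylb_depends _ k h (a :: w)) ?cylb_concat ?eqxx//.
  exact: leqW.
rewrite (meanZ mM) -?muE; last exact: bdd_bool.
by rewrite subrr normr0 mulr_ge0 ?prob_ge0// ltW.
Qed.

(** * Couplings *)

(** A mean on pairs with the right marginals and shift invariance on cylinders
    extends to a coupling. *)
Lemma dbar_le_mean {R : realType} (mu mu' : probability past R)
    (L : (past * past -> R) -> R) : is_mean L ->
  (forall w, L (fun q => (cylb w q.1)%:R) = prob mu (cylb w)) ->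
  (forall w, L (fun q => (cylb w q.2)%:R) = prob mu' (cylb w)) ->
  (forall F, bdd F -> L (fun q => F (shift2 q)) = L F) ->
  (dbar mu mu' <= (L (fun q => (q.1 0%N != q.2 0%N)%:R))%:E)%E.
Proof.
move=> mL L1 L2 Lshift; have [nu nuL] := mean_measure2 mL.
have d1 w : depends2 (size w) (fun q => cylb w q.1) by move=> q r /depends_cylb.
have d2 w : depends2 (size w) (fun q => cylb w q.2).
  by move=> q r _ /depends_cylb.
have cnu : coupling mu mu' nu.
  split.
  - have ms : measurable_fun setT shift2.
      apply/measurable_fun_pairP; split; apply: (measurableT_comp measurable_shift).
        exact: measurable_fst.
      exact: measurable_snd.
    have [nus nusE] := probability_image nu ms.
    move=> B mB; rewrite -nusE; apply: prob2_unique mB => n b db.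
    rewrite (nuL _ _ db) -(Lshift _ (bdd_bool _)) /prob nusE.
    apply: (nuL n.+1 (fun q => b (shift2 q))) => q r qr1 qr2; apply: db => /=.
      by move: qr1; rewrite !mkseq_shift => -[].
    by move: qr2; rewrite !mkseq_shift => -[].
  - have [nu1 nu1E] := probability_image nu (@measurable_fst _ _ past past).
    move=> B mB; rewrite -nu1E; apply: prob_past_unique mB => w.
    by rewrite -L1 -(nuL _ _ (d1 w)) /prob nu1E.
  - have [nu2 nu2E] := probability_image nu (@measurable_snd _ _ past past).
    move=> B mB; rewrite -nu2E; apply: prob_past_unique mB => w.
    by rewrite -L2 -(nuL _ _ (d2 w)) /prob nu2E.
have dne : depends2 1 (fun q : past * past => q.1 0%N != q.2 0%N).
  by move=> [? ?] [? ?] /= [->] [->].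
rewrite -(nuL _ _ dne) -probE; last exact: measurable_depends2 dne.
apply: ereal_inf_lbound; exists nu => //; congr (nu _).
by apply/seteqP; split=> q /= /eqP.
Qed.

(** It replaces integrals against a coupling by a mean, under which sums over
    words are finite linear algebra. *)
Lemma coupling_mean {R : realType} (mu mu' : probability past R)
    (nu : probability (past * past)%type R) : coupling mu mu' nu ->
  exists L : (past * past -> R) -> R, [/\ is_mean L,
    (forall n (b : past -> bool), depends n b ->
       L (fun q => (b q.1)%:R) = prob mu b),
    (forall n (b : past -> bool), depends n b ->
       L (fun q => (b q.2)%:R) = prob mu' b),
    (forall n (b : past * past -> bool), depends2 n b ->
       L (fun q => (b (shift2 q))%:R) = L (fun q => (b q)%:R)) &
    nu [set q : past * past | q.1 0%N <> q.2 0%N] =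
      (L (fun q => (q.1 0%N != q.2 0%N)%:R))%:E].
Proof.
move=> [inv m1 m2]; have [L mL nuL] := measure_mean2 nu; exists L; split=> //.
- move=> n b db; rewrite -(nuL n) => [|q r qr _]; last exact: db.
  by rewrite /prob -m1//; exact: measurable_depends db.
- move=> n b db; rewrite -(nuL n) => [|q r _ qr]; last exact: db.
  by rewrite /prob -m2//; exact: measurable_depends db.
- move=> n b db; rewrite -(nuL _ _ db) -(nuL n.+1) => [|q r qr1 qr2]; last first.
    apply: db => /=; first by move: qr1; rewrite !mkseq_shift => -[].
    by move: qr2; rewrite !mkseq_shift => -[].
  by rewrite /prob -(inv [set q | b q])//; exact: measurable_depends2 db.
- have dne : depends2 1 (fun q : past * past => q.1 0%N != q.2 0%N).
    by move=> [? ?] [? ?] /= [->] [->].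
  rewrite -(nuL _ _ dne) -probE; last exact: measurable_depends2 dne.
  by congr (nu _); apply/seteqP; split=> q /= /eqP.
Qed.

(** A coupling must disagree at 0 at least as often as the symbol +1 is more
    frequent in one marginal than in the other. *)
Lemma dbar_ge {R : realType} (mu mu' : probability past R) :
  ((prob mu (fun x => x 0%N) - prob mu' (fun x => x 0%N))%:E <= dbar mu mu')%E.
Proof.
apply/ereal_infP => _ [nu /coupling_mean[L [mL L1 L2 _ ->]] <-].
rewrite -(L1 _ _ (@depends_coord 0)) -(L2 _ _ (@depends_coord 0)) lee_fin.
rewrite -(meanB mL); [|exact: bdd_bool..].
apply: (mean_le mL) => [| |q]; [apply: bddB; exact: bdd_bool|exact: bdd_bool|].
by case: (q.1 0%N); case: (q.2 0%N); rewrite /=; lra.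
Qed.

Lemma dbar_ge0 {R : realType} (mu mu' : probability past R) :
  (0 <= dbar mu mu')%E.
Proof. by apply/ereal_infP => _ [nu _ <-]; exact: measure_ge0. Qed.

(** * The monotone coupling of two dynamics *)

Definition ordered : Type := {q : past * past | past_le q.1 q.2}.

Lemma past_le_concat a b x y :
  (a <= b)%O -> past_le x y -> past_le (concat a x) (concat b y).
Proof. by move=> ab xy [|n] /=. Qed.

Definition both (a : bool) (q : ordered) : ordered :=
  exist (fun q => past_le q.1 q.2) (concat a (sval q).1, concat a (sval q).2)
    (past_le_concat (lexx a) (svalP q)).

Definition split01 (q : ordered) : ordered :=
  exist (fun q => past_le q.1 q.2) (concat false (sval q).1, concat true (sval q).2)
    (@past_le_concat false true _ _ isT (svalP q)).

Section monotone_coupling.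
Context {R : realType} (g h : past -> R) (hg : regular g) (hh : regular h).
Hypothesis gh : forall x y, past_le x y ->
  g (concat true x) <= h (concat true y).

(** Both points receive +1 with probability g and both receive -1 with
    probability 1 - h; the remaining mass h - g is nonnegative on ordered
    pairs and goes to the step that puts -1 below and +1 above, so order is
    preserved. *)
Definition coupled_ruelle (F : ordered -> R) (q : ordered) : R :=
  g (concat true (sval q).1) * F (both true q) +
  (h (concat true (sval q).2) - g (concat true (sval q).1)) * F (split01 q) +
  h (concat false (sval q).2) * F (both false q).

Lemma coupled_ruelle_markov : markov_operator coupled_ruelle.
Proof.
move=> q; split=> [c F F' _ _|F _ F0|]; rewrite /coupled_ruelle.
- ring.
- rewrite !addr_ge0// mulr_ge0// ?(regular_ge0 hg) ?(regular_ge0 hh)//.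
  by rewrite subr_ge0; apply: gh; exact: (svalP q).
- by rewrite !mulr1 (regular_false hh); ring.
Qed.

Lemma coupled_ruelle_fst f :
  coupled_ruelle (fun q => f (sval q).1) = fun q => ruelle g f (sval q).1.
Proof.
apply/funext => q; rewrite /coupled_ruelle /ruelle /=.
by rewrite (regular_false hg) (regular_false hh); ring.
Qed.

Lemma coupled_ruelle_snd f :
  coupled_ruelle (fun q => f (sval q).2) = fun q => ruelle h f (sval q).2.
Proof. by apply/funext => q; rewrite /coupled_ruelle /ruelle /=; ring. Qed.

Lemma coupled_ruelle_shift (F : past * past -> R) :
  coupled_ruelle (fun q => F (shift2 (sval q))) = fun q => F (sval q).
Proof.
apply/funext => -[[x y] xy]; rewrite /coupled_ruelle /shift2 /=.
by rewrite (regular_false hh); ring.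
Qed.

(** Each coordinate of the coupled dynamics follows its own kernel, so the
    time averages have the right marginals; they live on ordered pairs because
    the dynamics does. *)
Lemma monotone_coupling x y : past_le x y ->
  exists L : (past * past -> R) -> R, [/\ is_mean L,
    (forall f, L (fun q => f q.1) = ergodic_mean (ruelle g) x f),
    (forall f, L (fun q => f q.2) = ergodic_mean (ruelle h) y f),
    (forall F, bdd F -> L (fun q => F (shift2 q)) = L F) &
    (forall F G, bdd F -> bdd G ->
      (forall q, past_le q.1 q.2 -> F q <= G q) -> L F <= L G)].
Proof.
move=> xy; pose z : ordered := exist (fun q => past_le q.1 q.2) (x, y) xy.
pose M := ergodic_mean coupled_ruelle z.
have mM : is_mean M := ergodic_mean_mean coupled_ruelle_markov z.
exists (fun F => M (fun q => F (sval q))); split.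
- exact: mean_pullback mM.
- move=> f; rewrite /M /ergodic_mean; congr glim; apply/funext => n.
  apply: eq_bigr => t _; congr (_ * _).
  suff -> : iter t coupled_ruelle (fun q => f (sval q).1) =
    fun q => iter t (ruelle g) f (sval q).1 by [].
  elim: {n t}(t : nat) => //= t IH.
  by rewrite IH coupled_ruelle_fst.
- move=> f; rewrite /M /ergodic_mean; congr glim; apply/funext => n.
  apply: eq_bigr => t _; congr (_ * _).
  suff -> : iter t coupled_ruelle (fun q => f (sval q).2) =
    fun q => iter t (ruelle h) f (sval q).2 by [].
  elim: {n t}(t : nat) => //= t IH.
  by rewrite IH coupled_ruelle_snd.
- move=> F Fb; rewrite /M -(ergodic_mean_invariant coupled_ruelle_markov).
    by rewrite coupled_ruelle_shift.
  exact: (bdd_comp (fun q : ordered => shift2 (sval q)) Fb).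
- move=> F G Fb Gb FG; apply: (mean_le mM) => [| |q]; [exact: bdd_comp..|].
  exact/FG/(svalP q).
Qed.

End monotone_coupling.

(** On an ordered pair, the indicator of a disagreement at 0 is the difference
    of the two indicators of +1. *)
Lemma dbar_monotone {R : realType} (g h : past -> R) x y
    (mu mu' : probability past R) : regular g -> regular h ->
  (forall x y, past_le x y -> g (concat true x) <= h (concat true y)) ->
  past_le x y ->
  (forall n (b : past -> bool), depends n b ->
    prob mu b = ergodic_mean (ruelle g) x (fun x => (b x)%:R)) ->
  (forall n (b : past -> bool), depends n b ->
    prob mu' b = ergodic_mean (ruelle h) y (fun x => (b x)%:R)) ->
  (dbar mu mu' <=
     (prob mu' (fun x => x 0%N) - prob mu (fun x => x 0%N))%:E)%E /\
  (dbar mu' mu <=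
     (prob mu' (fun x => x 0%N) - prob mu (fun x => x 0%N))%:E)%E.
Proof.
move=> hg hh gh xy muE muE'.
have [L [mL L1 L2 Lshift Lord]] := monotone_coupling hg hh gh xy.
pose ne (q : past * past) : R := (q.1 0%N != q.2 0%N)%:R.
have Lne : L ne <= prob mu' (fun x => x 0%N) - prob mu (fun x => x 0%N).
  rewrite (muE _ _ (@depends_coord 0)) (muE' _ _ (@depends_coord 0)) -L1 -L2.
  rewrite -(meanB mL); [|exact: bdd_bool..].
  apply: Lord => [| |q /(_ 0%N)]; first exact: bdd_bool.
    by apply: bddB; exact: bdd_bool.
  by rewrite /ne; case: (q.1 0%N); case: (q.2 0%N); rewrite /= ?subrr ?subr0.
split.
- apply: (@le_trans _ _ (L ne)%:E); last by rewrite lee_fin.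
  apply: (dbar_le_mean mL) => // w.
  + by rewrite (L1 (fun x => (cylb w x)%:R)) (muE _ _ (@depends_cylb w)).
  + by rewrite (L2 (fun x => (cylb w x)%:R)) (muE' _ _ (@depends_cylb w)).
- apply: (@le_trans _ _ (L (fun q => (q.2 0%N != q.1 0%N)%:R))%:E); last first.
    by rewrite lee_fin; under eq_fun do rewrite eq_sym.
  apply: (dbar_le_mean (mean_pullback (fun q => (q.2, q.1)) mL)) => /= [w|w|F Fb].
  + by rewrite (L2 (fun x => (cylb w x)%:R)) (muE' _ _ (@depends_cylb w)).
  + by rewrite (L1 (fun x => (cylb w x)%:R)) (muE _ _ (@depends_cylb w)).
  + exact: (Lshift (fun q => F (q.2, q.1)) (bdd_comp _ Fb)).
Qed.

(** * Comparison of a g-measure with the dynamics of a larger function *)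

Definition increasing {R : realType} (f : past -> R) :=
  forall x y, past_le x y -> f x <= f y.

(** Along a class of functions that the dynamics preserves, L increases under
    iteration and stays below the value at the extremal point z; average over
    the iterates. *)
Lemma mean_le_ergodic {R : realType} (L : (past -> R) -> R)
    (P : (past -> R) -> past -> R) z (S : (past -> R) -> Prop) :
  is_mean L -> markov_operator P ->
  (forall f, S f -> bdd f) -> (forall f, S f -> S (P f)) ->
  (forall f, S f -> L f <= L (P f)) -> (forall f, S f -> L f <= f z) ->
  forall f, S f -> L f <= ergodic_mean P z f.
Proof.
move=> mL mP Sb SP LP Lz f Sf.
have iterS t : S (iter t P f) by elim: t => //= t; exact: SP.
have Lt t : L f <= iter t P f z.
  apply: le_trans (Lz _ (iterS t)); elim: t => // t IH.
  exact: le_trans IH (LP _ (iterS t)).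
rewrite -(glim_cst (L f)); apply: glim_le.
- exact: bdd_cst.
- by have [B fB] := Sb _ Sf; exists B => n; exact: (mean_bound (cesaro_mean mP z n)).
- apply: nearW => n; rewrite /cesaro -mulr_sumr.
  rewrite ler_pdivlMl ?ltr0n// mulr_natl -[n.+1 in leLHS]card_ord -sumr_const.
  by apply: ler_sum => t _; exact: Lt.
Qed.

Section compare.
Context {R : realType} (g : past -> R) (hg : regular g)
  (mu : probability past R) (gmu : g_measure g mu)
  (L : (past -> R) -> R) (mL : is_mean L)
  (muL : forall w, prob mu (cylb w) = L (fun x => (cylb w x)%:R))
  (h : past -> R) (hh : regular h) (k : nat) (dh : depends k h).

(** The monotone coupling of the dynamics h with itself, in one step. *)
Lemma increasing_ruelle f : increasing (fun x => h (concat true x)) ->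
  increasing f -> increasing (ruelle h f).
Proof.
move=> ih inf x y xy; rewrite /ruelle !(regular_false hh).
have h0 := regular_ge0 hh (concat true x).
have h1 := regular_le1 hh (concat true y).
have hxy := ih _ _ xy.
have f1 : f (concat true x) <= f (concat true y).
  by apply: inf; exact: past_le_concat.
have f0 : f (concat false x) <= f (concat false y).
  by apply: inf; exact: past_le_concat.
have f01 : f (concat false y) <= f (concat true y).
  by apply: inf; apply: past_le_concat => // n.
nra.
Qed.

Lemma depends_maxn_ruelle n (f : past -> R) :
  depends n f -> depends (maxn n k) (ruelle h f).
Proof.
move=> df; apply: depends_ruelle.
  exact: depends_le (leq_maxr _ _) dh.
exact: depends_le (leq_maxl _ _) df.
Qed.

(** A g-measure is invariant under the dynamics of g, which on increasing
    functions is dominated by that of h; the constant past +1 is the largest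
    starting point. *)
Lemma g_measure_le_ergodic n (f : past -> R) :
  (forall x, g (concat true x) <= h (concat true x)) ->
  increasing (fun x => h (concat true x)) -> increasing f -> depends n f ->
  L f <= ergodic_mean (ruelle h) (fun=> true) f.
Proof.
move=> gh ih inf df.
pose S (f : past -> R) := increasing f /\ exists n, depends n f.
apply: (mean_le_ergodic (S := S) mL (ruelle_markov hh)) => [u|u|u|u|].
- by move=> [_ [m /depends_bdd]].
- move=> [iu [m du]]; split; first exact: increasing_ruelle.
  by exists (maxn m k); exact: depends_maxn_ruelle.
- move=> [iu [m du]]; rewrite -(g_measure_ruelle hg gmu mL muL du).
  have ub := depends_bdd du.
  apply: (mean_le mL) => [| |x]; [exact: ruelle_bdd..|].
  rewrite /ruelle (regular_false hg) (regular_false hh).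
  have : u (concat false x) <= u (concat true x).
    by apply: iu; exact: past_le_concat.
  have := gh x; nra.
- move=> [iu [m /depends_bdd ub]]; rewrite -(mean_cst mL (u _)).
  apply: (mean_le mL) => // [|x]; first exact: bdd_cst.
  by apply: iu => i; rewrite /=; case: (x i).
- by split=> //; exists n.
Qed.

Lemma ruelleN f : ruelle h (fun x => - f x) = fun x => - ruelle h f x.
Proof. by apply/funext => x; rewrite /ruelle; ring. Qed.

(** The same comparison for the opposite functions, started at the smallest
    past. *)
Lemma ergodic_le_g_measure n (f : past -> R) :
  (forall x, h (concat true x) <= g (concat true x)) ->
  increasing (fun x => h (concat true x)) -> increasing f -> depends n f ->
  ergodic_mean (ruelle h) (fun=> false) f <= L f.
Proof.
move=> hg' ih inf df; have fb := depends_bdd df.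
have mM := ergodic_mean_mean (ruelle_markov hh) (fun=> false).
rewrite -lerN2 -(meanN mL)// -(meanN mM)//.
pose S (f : past -> R) := increasing (fun x => - f x) /\ exists n, depends n f.
apply: (mean_le_ergodic (S := S) mL (ruelle_markov hh)) => [u|u|u|u|].
- by move=> [_ [m /depends_bdd]].
- move=> [iu [m du]]; split.
    by have := increasing_ruelle ih iu; rewrite ruelleN.
  by exists (maxn m k); exact: depends_maxn_ruelle.
- move=> [iu [m du]]; rewrite -(g_measure_ruelle hg gmu mL muL du).
  have ub := depends_bdd du.
  apply: (mean_le mL) => [| |x]; [exact: ruelle_bdd..|].
  rewrite /ruelle (regular_false hg) (regular_false hh).
  have : - u (concat false x) <= - u (concat true x).
    by apply: iu; exact: past_le_concat.
  have := hg' x; nra.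
- move=> [iu [m /depends_bdd ub]]; rewrite -(mean_cst mL (u _)).
  apply: (mean_le mL) => // [|x]; first exact: bdd_cst.
  by rewrite -lerN2; apply: iu.
- split; first by move=> x y xy; rewrite !opprK; exact: inf.
  by exists n => x y xy; rewrite (df x y xy).
Qed.

End compare.

(** * Markov approximations *)

Definition truncate (c : bool) (n : nat) (x : past) : past := pad c (mkseq x n).

Lemma truncateE c n x i : truncate c n x i = if (i < n)%N then x i else c.
Proof.
rewrite /truncate /pad; case: ltnP => ni; first by rewrite nth_mkseq.
by rewrite nth_default// size_mkseq.
Qed.

Lemma truncate_concat c n a x :
  truncate c n.+1 (concat a x) = concat a (truncate c n x).
Proof. by rewrite /truncate mkseq_concat pad_cons. Qed.

Lemma mkseq_truncate c n x : mkseq (truncate c n x) n = mkseq x n.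
Proof. by apply/mkseqP => i lt_in; rewrite truncateE lt_in. Qed.

Lemma depends_truncate T c n (f : past -> T) : depends n (fun x => f (truncate c n x)).
Proof. by move=> x y xy; rewrite /truncate xy. Qed.

Lemma continuous_depends {R : realType} n (f : past -> R) :
  depends n f -> continuous f.
Proof.
move=> df; apply/continuous_pastP => x e e0; exists n => y yx.
by rewrite (df y x yx) subrr normr0.
Qed.

(** For an attractive g, filling the past with +1 gives an upper and filling
    it with -1 a lower approximation. *)
Definition markov_approx {R : realType} (g : past -> R) (c : bool) (j : nat)
  (x : past) : R := g (truncate c j.+1 x).

Section approx.
Context {R : realType} (g : past -> R) (hg : regular g).

Lemma markov_approx_depends c j : depends j.+1 (markov_approx g c j).
Proof. exact: depends_truncate. Qed.

Lemma markov_approx_concat c j a x :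
  markov_approx g c j (concat a x) = g (concat a (truncate c j x)).
Proof. by rewrite /markov_approx truncate_concat. Qed.

Lemma markov_approx_regular c j : regular (markov_approx g c j).
Proof.
case: (hg) => _ g01 gs; split=> [|x|x].
- exact: continuous_depends (@markov_approx_depends c j).
- exact: g01.
- by under eq_bigr do rewrite markov_approx_concat; exact: gs.
Qed.

Lemma markov_approx_markov c j : some_markov_kernel (markov_approx g c j).
Proof.
exists j; split; first exact: markov_approx_regular.
by move=> x y xy; apply: markov_approx_depends; apply/mkseqP => i; exact: xy.
Qed.

Lemma markov_approx_cvg c : {uniform, markov_approx g c @ \oo --> g}.
Proof.
case: (hg) => cg _ _ U /uniform_nbhs[V [eV VU]].
have [e e0 eV'] : exists2 e : R, 0 < e & forall a b : R, `|a - b| < e -> V (a, b).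
  move: eV => /= [e /= e0 eV']; exists e => // a b ab; apply: (eV' (a, b)); exact: ab.
have [m gm] := continuous_past_unif cg e0.
exists m => // j /= mj; apply: VU => x _; apply: eV'; apply: gm.
by apply: (@mkseq_le _ _ m j.+1); rewrite ?mkseq_truncate// leqW.
Qed.

End approx.

Section increasing_approx.
Context {R : realType} (g : past -> R) (hg : regular g) (ag : attractive g).

Lemma attractive_true : increasing (fun x => g (concat true x)).
Proof.
have E z : \sum_(b : bool | (true <= b)%O) g (concat b z) = g (concat true z).
  by rewrite big_mkcond big_bool /= addr0.
by move=> x y /(ag true); rewrite !E.
Qed.

Lemma approx_true_decreasing j x y : past_le x y ->
  markov_approx g true j.+1 (concat true x) <= markov_approx g true j (concat true y).
Proof.
move=> xy; rewrite !markov_approx_concat; apply: attractive_true => i.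
rewrite !truncateE; case: (ltnP i j) => ij; first by rewrite ltnS (ltnW ij); exact: xy.
by case: ifP => // _; case: (x i).
Qed.

Lemma approx_false_increasing j x y : past_le x y ->
  markov_approx g false j (concat true x) <= markov_approx g false j.+1 (concat true y).
Proof.
move=> xy; rewrite !markov_approx_concat; apply: attractive_true => i.
by rewrite !truncateE; case: (ltnP i j) => ij; first by rewrite ltnS (ltnW ij); exact: xy.
Qed.

Lemma approx_false_true j x y : past_le x y ->
  markov_approx g false j (concat true x) <= markov_approx g true j (concat true y).
Proof.
move=> xy; rewrite !markov_approx_concat; apply: attractive_true => i.
by rewrite !truncateE; case: ifP => // _; exact: xy.
Qed.

Lemma approx_increasing c j :
  increasing (fun x => markov_approx g c j (concat true x)).
Proof.
move=> x y xy; rewrite !markov_approx_concat; apply: attractive_true => i.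
by rewrite !truncateE; case: ifP => // _; exact: xy.
Qed.

Lemma approx_true_ge j x :
  g (concat true x) <= markov_approx g true j (concat true x).
Proof.
rewrite markov_approx_concat; apply: attractive_true => i.
by rewrite truncateE; case: ifP => // _; case: (x i).
Qed.

Lemma approx_false_le j x :
  markov_approx g false j (concat true x) <= g (concat true x).
Proof.
rewrite markov_approx_concat; apply: attractive_true => i.
by rewrite truncateE; case: ifP.
Qed.

(** Time averages of each approximation, started at its own extremal past. *)
Let M c j := ergodic_mean (ruelle (markov_approx g c j)) (fun=> c).

Lemma approx_mean c j : is_mean (M c j).
Proof. exact/ergodic_mean_mean/ruelle_markov/markov_approx_regular. Qed.

(** On an ordered pair the event can tell the two points apart only if one of
    the first n symbols is -1 below and +1 above; by stationarity every symbol
    contributes equally. *)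
Lemma approx_gap j n (b : past -> bool) : depends n b ->
  increasing (fun x => (b x)%:R : R) ->
  M true j (fun x => (b x)%:R) - M false j (fun x => (b x)%:R) <=
  n%:R * (M true j (fun x => (x 0%N)%:R) - M false j (fun x => (x 0%N)%:R)).
Proof.
move=> db ib.
have [L [mL L1 L2 _ Lord]] := monotone_coupling (markov_approx_regular hg false j)
  (markov_approx_regular hg true j) (@approx_false_true j) 
  (x := fun=> false) (y := fun=> true) (fun _ => isT).
have E : L (fun q => \sum_(i < n) ((q.2 i)%:R - (q.1 i)%:R)) = 
    n%:R * (M true j (fun x => (x 0%N)%:R) - M false j (fun x => (x 0%N)%:R)).
  rewrite (mean_sum mL) => [|i]; last by apply: bddB; exact: bdd_bool.
  rewrite (eq_bigr (fun=> M true j (fun x => (x 0%N)%:R) -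
      M false j (fun x => (x 0%N)%:R))) => [|i _].
    by rewrite sumr_const card_ord mulr_natl.
  rewrite (meanB mL); [|exact: bdd_bool..].
  rewrite (L1 (fun x => (x i)%:R)) (L2 (fun x => (x i)%:R)) /M.
  by rewrite !(ergodic_mean_coord (markov_approx_regular hg _ j) _ i).
rewrite -E /M -(L1 (fun x => (b x)%:R)) -(L2 (fun x => (b x)%:R)).
rewrite -(meanB mL); [|exact: bdd_bool..].
apply: Lord => [| |q qle].
- by apply: bddB; exact: bdd_bool.
- by apply: bdd_sum => i; apply: bddB; exact: bdd_bool.
have nn (i : 'I_n) : true -> 0 <= (q.2 i)%:R - (q.1 i)%:R :> R.
  by move=> _; have := qle i; case: (q.1 i); case: (q.2 i) => //=; rewrite ?subrr ?subr0.
have [qq|qq] := eqVneq (mkseq q.1 n) (mkseq q.2 n).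
  by rewrite (db _ _ qq) subrr sumr_ge0.
have [i qi] : exists i : 'I_n, q.1 i != q.2 i.
  apply: contrapT => noi; case/eqP: qq; apply/mkseqP => i lt_in.
  by apply/eqP/negPn/negP => qi; apply: noi; exists (Ordinal lt_in).
rewrite (bigD1 i)//= (@le_trans _ _ ((q.2 i)%:R - (q.1 i)%:R))//.
  by have := qle i; move: qi; case: (q.1 i); case: (q.2 i) => //= _ _;
    case: (b _); case: (b _); rewrite /=; lra.
by rewrite lerDl sumr_ge0// => k _; exact: nn.
Qed.

(** Indicators of increasing events that generate: the cylinder of w is the
    difference of the event of being above w and the event of being strictly
    above w. *)
Definition above (w : seq bool) (x : past) : bool :=
  [forall i : 'I_(size w), (nth false w i <= x i)%O].

Definition strictly_above (w : seq bool) (x : past) : bool :=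
  above w x && ~~ cylb w x.

Lemma increasing_bool (b : past -> bool) :
  (forall x y, past_le x y -> b x -> b y) -> increasing (fun x => (b x)%:R : R).
Proof.
move=> bxy x y xy; have := bxy _ _ xy.
by case: (b x); case: (b y) => // /(_ isT).
Qed.

Lemma above_le w x y : past_le x y -> above w x -> above w y.
Proof.
move=> xy /forallP wx; apply/forallP => i; exact: le_trans (wx i) (xy i).
Qed.

Lemma strictly_above_le w x y :
  past_le x y -> strictly_above w x -> strictly_above w y.
Proof.
move=> xy /andP[wx xw]; apply/andP; split; first exact: above_le wx.
apply: contra xw => /eqP yw; apply/eqP; rewrite -[RHS]yw.
apply/mkseqP => i lt_iw; apply/eqP; rewrite eq_le xy /=.
have := forallP wx (Ordinal lt_iw); rewrite /= -{1}yw nth_mkseq//.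
Qed.

Lemma depends_above w : depends (size w) (above w).
Proof.
move=> x y /mkseqP xy; apply/eq_forallb => i; by rewrite xy.
Qed.

Lemma depends_strictly_above w : depends (size w) (strictly_above w).
Proof.
by move=> x y xy; rewrite /strictly_above (depends_above xy) (depends_cylb xy).
Qed.

Lemma cylb_above w x : (cylb w x)%:R = (above w x)%:R - (strictly_above w x)%:R :> R.
Proof.
rewrite /strictly_above; case: (boolP (cylb w x)) => [/eqP xw|]; last first.
  by rewrite andbT subrr.
rewrite andbF subr0 (_ : above w x)//; apply/forallP => i.
by have := nth_mkseq false x (ltn_ord i); rewrite xw => ->.
Qed.

(** All g-measures lie between the lower and the upper approximation on
    increasing events, and these determine a measure. *)
Lemma g_measure_unique (mu mu' : probability past R) :
  (forall d, 0 < d -> exists j,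
    M true j (fun x => (x 0%N)%:R) - M false j (fun x => (x 0%N)%:R) < d) ->
  g_measure g mu -> g_measure g mu' -> same_measure mu mu'.
Proof.
move=> gap gmu gmu'.
have [L mL muL] := measure_mean mu; have [L' mL' muL'] := measure_mean mu'.
have muLc w : prob mu (cylb w) = L (fun x => (cylb w x)%:R).
  exact: muL (@depends_cylb w).
have muLc' w : prob mu' (cylb w) = L' (fun x => (cylb w x)%:R).
  exact: muL' (@depends_cylb w).
have LL' n (b : past -> bool) : depends n b ->
    (forall x y, past_le x y -> b x -> b y) ->
    L (fun x => (b x)%:R) = L' (fun x => (b x)%:R).
  move=> db /increasing_bool ib; apply/eqP; rewrite eq_sym -subr_eq0 -normr_eq0.
  apply/negP => /negP d0.
  have dgt0 : 0 < `|L' (fun x => (b x)%:R) - L (fun x => (b x)%:R)|.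
    by rewrite lt_neqAle eq_sym d0/=.
  (* A gap below D / (n + 1), multiplied by the n symbols of the event, forces
     the two values to be closer than D, their actual distance. *)
  have [j gj] := gap _ (divr_gt0 dgt0 (ltr0Sn R n)).
  have dbR : depends n (fun x => (b x)%:R : R) by move=> x y xy; rewrite (db x y xy).
  have up := g_measure_le_ergodic hg gmu mL muLc
    (markov_approx_regular hg true j) (@markov_approx_depends R g true j)
    (approx_true_ge j) (@approx_increasing true j) ib dbR.
  have up' := g_measure_le_ergodic hg gmu' mL' muLc'
    (markov_approx_regular hg true j) (@markov_approx_depends R g true j)
    (approx_true_ge j) (@approx_increasing true j) ib dbR.
  have lo := ergodic_le_g_measure hg gmu mL muLc
    (markov_approx_regular hg false j) (@markov_approx_depends R g false j)
    (approx_false_le j) (@approx_increasing false j) ib dbR.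
  have lo' := ergodic_le_g_measure hg gmu' mL' muLc'
    (markov_approx_regular hg false j) (@markov_approx_depends R g false j)
    (approx_false_le j) (@approx_increasing false j) ib dbR.
  have := approx_gap j db ib; move: gj; rewrite ltr_pdivlMr ?ltr0n// -natr1.
  set X := M true j _ - M false j _; set D := `|_| => Xn Dn.
  have DM : D <= M true j (fun x => (b x)%:R) - M false j (fun x => (b x)%:R).
    by rewrite /D /M ler_norml; apply/andP; split; lra.
  have {}Dn := le_trans DM Dn; have := lt_le_trans Xn Dn.
  rewrite mulrDr mulr1 mulrC gtrDl => X0.
  have := le_trans Dn (mulr_ge0_le0 (ler0n R n) (ltW X0)).
  by rewrite leNgt dgt0.
apply: prob_past_unique => w; rewrite muLc muLc'.
have -> : (fun x => (cylb w x)%:R) =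
    fun x => (above w x)%:R - (strictly_above w x)%:R :> R.
  by apply/funext => x; exact: cylb_above.
rewrite (meanB mL) ?(meanB mL'); [|exact: bdd_bool..].
rewrite (LL' _ _ (@depends_above w) (@above_le w)).
by rewrite (LL' _ _ (@depends_strictly_above w) (@strictly_above_le w)).
Qed.

End increasing_approx.

(** The gap between the densities of +1 decreases in j and the terms of the
    two series are bounded by its decrements; since the gap stays at least
    some d > 0, the sum of the series misses the initial gap by d. *)
Lemma multiple_dbar_gap {R : realType} (g : past -> R) :
  regular g -> attractive g ->
  (exists mu mu' : probability past R,
     [/\ g_measure g mu, g_measure g mu' & ~ same_measure mu mu']) ->
  exists (mu mu' : nat -> probability past R),
    (forall j, g_measure (markov_approx g true j) (mu j) /\
               g_measure (markov_approx g false j) (mu' j)) /\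
    (\sum_(0 <= j <oo) dbar (mu j) (mu j.+1)
     + \sum_(0 <= j <oo) dbar (mu' j) (mu' j.+1) < dbar (mu 0%N) (mu' 0%N))%E.
Proof.
move=> hg ag [nu [nu' [gnu gnu' nunu']]].
pose M c j := ergodic_mean (ruelle (markov_approx g c j)) (fun=> c).
have hM c j := markov_approx_regular hg c j.
have /choice[mu muE] j := mean_measure (approx_mean hg true j).
have /choice[mu' muE'] j := mean_measure (approx_mean hg false j).
exists mu, mu'; split=> [j|].
  have dM c := @markov_approx_depends R g c j.
  split.
    apply: (ergodic_g_measure (hM true j) (dM true)) => w.
    exact: muE (@depends_cylb w).
  apply: (ergodic_g_measure (hM false j) (dM false)) => w.
  exact: muE' (@depends_cylb w).
pose A j := prob (mu j) (fun x => x 0%N); pose B j := prob (mu' j) (fun x => x 0%N).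
have AE j : A j = M true j (fun x => (x 0%N)%:R) := muE j _ _ (@depends_coord 0).
have BE j : B j = M false j (fun x => (x 0%N)%:R) := muE' j _ _ (@depends_coord 0).
have [d d0 gap] : exists2 d, 0 < d & forall j, d <= A j - B j.
  apply: contrapT => nogap; apply: nunu'.
  apply: (g_measure_unique hg ag) gnu gnu' => d d0.
  apply: contrapT => nod; apply: nogap; exists d => // j.
  by rewrite leNgt; apply/negP => dj; apply: nod; exists j; move: dj; rewrite AE BE.
have dA j : (dbar (mu j) (mu j.+1) <= (A j - A j.+1)%:E)%E.
  have [_] := dbar_monotone (hM true j.+1) (hM true j)
    (@approx_true_decreasing _ _ ag j) (x := fun=> true) (y := fun=> true)
    (fun=> isT) (muE j.+1) (muE j).
  exact.
have dB j : (dbar (mu' j) (mu' j.+1) <= (B j.+1 - B j)%:E)%E.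
  have [+ _] := dbar_monotone (hM false j) (hM false j.+1)
    (@approx_false_increasing _ _ ag j) (x := fun=> false) (y := fun=> false)
    (fun=> isT) (muE' j) (muE' j.+1).
  exact.
rewrite -nneseriesD; [|by move=> *; exact: dbar_ge0..].
apply: (@le_lt_trans _ _ (A 0%N - B 0%N - d)%:E); last first.
  apply: lt_le_trans (dbar_ge (mu 0%N) (mu' 0%N)).
  by rewrite lte_fin -/(A _) -/(B _); lra.
apply: lime_le.
  by apply: is_cvg_nneseries => n _ _; rewrite adde_ge0// dbar_ge0.
apply: nearW => n.
apply: (@le_trans _ _ (\sum_(0 <= j < n) ((A j - B j) - (A j.+1 - B j.+1))%:E)%E).
  apply: lee_sum => j _; apply: le_trans (leeD (dA j) (dB j)) _.
  by rewrite -EFinD lee_fin; lra.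
rewrite sumEFin lee_fin.
suff -> : \sum_(0 <= j < n) (A j - B j - (A j.+1 - B j.+1)) =
    (A 0%N - B 0%N) - (A n - B n) by have := gap n; lra.
elim: n => [|n IH]; first by rewrite big_geq// subrr.
by rewrite big_nat_recr//= IH; ring.
Qed.

(** * Limits of g-measures *)

Lemma prob_cyl_bdd {R : realType} (mu : nat -> probability past R) w :
  bdd (fun j => prob (mu j) (cylb w)).
Proof.
exists 1 => j; rewrite ger0_norm ?prob_ge0// prob_le1//; exact: measurable_cyl.
Qed.

(** The conditional ratios are closed conditions on finitely many cylinders,
    with an error that is uniform for kernels close to g. *)
Lemma glim_g_measure {R : realType} (g : past -> R) (gj : nat -> past -> R)
    (mu : nat -> probability past R) :
  regular g -> (forall j, regular (gj j)) ->
  (forall e, 0 < e -> \forall j \near \oo, forall x, `|gj j x - g x| <= e) ->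
  (forall j, g_measure (gj j) (mu j)) ->
  exists nu : probability past R, g_measure g nu /\
    forall w, prob nu (cylb w) = glim (fun j => prob (mu j) (cylb w)).
Proof.
move=> hg hgj gjg gmu.
have /choice[L LP] j : exists L : (past -> R) -> R, is_mean L /\
    forall n b, depends n b -> prob (mu j) b = L (fun x => (b x)%:R).
  by have [L mL muL] := measure_mean (mu j); exists L.
have [nu nuL] := mean_measure (mean_glim (fun j => (LP j).1)).
have nuE w : prob nu (cylb w) = glim (fun j => prob (mu j) (cylb w)).
  rewrite (nuL _ _ (@depends_cylb w)); congr glim; apply/funext => j.
  by rewrite (proj2 (LP j) _ _ (@depends_cylb w)).
exists nu; split=> //; apply: ratios_g_measure => // e e0.
have e20 : 0 < e / 2 by rewrite divr_gt0.
have [m gm] := regular_oscillation hg e20.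
exists m => w mw a; rewrite !nuE.
pose p j := prob (mu j) (cylb w); pose q j := prob (mu j) (cylb (a :: w)).
have pb : bdd p := prob_cyl_bdd mu w.
have qb : bdd q := prob_cyl_bdd mu (a :: w).
rewrite -/p -/q; set c := g _.
have -> : glim q - c * glim p = glim (fun j => - c * p j + q j).
  by rewrite glim_linear// mulNr addrC.
have db : bdd (fun j => - c * p j + q j) by apply: bddD => //; exact: bddZ.
have -> : e * glim p = glim (fun j => e * p j).
  under [in RHS]eq_fun do rewrite -[e * _]addr0.
  by rewrite glim_linear ?glim_cst ?addr0//; exact: bdd_cst.
rewrite -glim_norm//; apply: glim_le; [exact: bdd_norm|exact: bddZ|].
apply: filterS (gjg _ e20) => j gjj; rewrite addrC mulNr.
apply: (g_measure_cyl (hgj j) (gmu j)) => x xw.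
have := gm w mw a x xw; have := gjj (concat a x); rewrite -/c.
by rewrite !ler_norml => /andP[? ?] /andP[? ?]; apply/andP; split; lra.
Qed.

(** * Finite transport *)

Definition transport {R : realType} {W : finType} (c : W -> W -> R)
    (p q : W -> R) (t : R) :=
  exists pi : W -> W -> R, [/\ forall w w', 0 <= pi w w',
    forall w, \sum_w' pi w w' = p w, forall w', \sum_w pi w w' = q w' &
    \sum_w \sum_w' pi w w' * c w w' <= t].

Section transport.
Context {R : realType} {W : finType} (c : W -> W -> R).
Implicit Types p q r : W -> R.

Lemma transport_le p q s t : s <= t -> transport c p q s -> transport c p q t.
Proof.
by move=> st [pi [pi0 pip piq pis]]; exists pi; split=> //; exact: le_trans st.
Qed.

Lemma transport_sym p q t : (forall w w', c w w' = c w' w) ->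
  transport c p q t -> transport c q p t.
Proof.
move=> csym [pi [pi0 pip piq pit]]; exists (fun w w' => pi w' w); split=> //.
rewrite exchange_big /=; under eq_bigr do under eq_bigr do rewrite csym.
exact: pit.
Qed.

(** The two plans are glued by making the endpoints independent given the
    intermediate word v. If v has no mass, the division by 0 is harmless
    because the numerator vanishes. *)
Lemma transport_trans p q r s t : (forall w w' w'', c w w'' <= c w w' + c w' w'') ->
  transport c p q s -> transport c q r t -> transport c p r (s + t).
Proof.
move=> ctri [pi [pi0 pip piq pis]] [rho [rho0 rhoq rhor rhot]].
have q0 v : 0 <= q v by rewrite -piq sumr_ge0.
pose k w v w' := pi w v * rho v w' / q v.
have k0 w v w' : 0 <= k w v w' by rewrite /k mulr_ge0 ?invr_ge0// mulr_ge0.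
have zero v : q v = 0 -> (forall w, pi w v = 0) /\ (forall w', rho v w' = 0).
  move=> qv; split=> w.
    have /eqP := piq v; rewrite qv psumr_eq0// => /allP/(_ w).
    by rewrite mem_index_enum => /(_ isT)/eqP.
  have /eqP := rhoq v; rewrite qv psumr_eq0// => /allP/(_ w).
  by rewrite mem_index_enum => /(_ isT)/eqP.
have kr w v : \sum_w' k w v w' = pi w v.
  rewrite /k -mulr_suml -mulr_sumr rhoq.
  have [qv|qv] := eqVneq (q v) 0; last by rewrite mulfK.
  by have [-> _] := zero v qv; rewrite !mul0r.
have kl v w' : \sum_w k w v w' = rho v w'.
  rewrite /k -mulr_suml -mulr_suml piq.
  have [qv|qv] := eqVneq (q v) 0; last by rewrite mulrC mulKf.
  by have [_ ->] := zero v qv; rewrite mulr0 mul0r.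
exists (fun w w' => \sum_v k w v w'); split.
- by move=> w w'; rewrite sumr_ge0.
- by move=> w; rewrite exchange_big /= -pip; apply: eq_bigr => v _.
- by move=> w'; rewrite exchange_big /= -rhor; apply: eq_bigr => v _.
have -> : \sum_w \sum_w' (\sum_v k w v w') * c w w' =
    \sum_w \sum_w' \sum_v k w v w' * c w w'.
  by apply: eq_bigr => w _; apply: eq_bigr => w' _; rewrite mulr_suml.
apply: le_trans (lerD pis rhot).
have -> : \sum_w \sum_v pi w v * c w v = \sum_w \sum_w' \sum_v k w v w' * c w v.
  apply: eq_bigr => w _; rewrite exchange_big /=; apply: eq_bigr => v _.
  by rewrite -mulr_suml kr.
have -> : \sum_v \sum_w' rho v w' * c v w' =
    \sum_w \sum_w' \sum_v k w v w' * c v w'.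
  rewrite exchange_big /= [RHS]exchange_big /=; apply: eq_bigr => w' _.
  rewrite exchange_big /=; apply: eq_bigr => v _.
  by rewrite -mulr_suml kl.
rewrite -big_split /=; apply: ler_sum => w _.
rewrite -big_split /=; apply: ler_sum => w' _.
rewrite -big_split /=; apply: ler_sum => v _.
by rewrite -mulrDr ler_wpM2l.
Qed.

(** The common part of p and q stays in place, and the rest of p is spread
    proportionally over the rest of q. *)
Lemma transport_tv p q C : (forall w, 0 <= p w) -> (forall w, 0 <= q w) ->
  \sum_w p w = \sum_w q w -> (forall w, c w w = 0) ->
  (forall w w', c w w' <= C) -> 0 <= C ->
  transport c p q (C * \sum_w `|p w - q w|).
Proof.
move=> p0 q0 pq c0 cC C0.
pose m w := Num.min (p w) (q w).
have pm w : 0 <= p w - m w by rewrite subr_ge0 ge_min lexx.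
have qm w : 0 <= q w - m w by rewrite subr_ge0 ge_min lexx orbT.
pose d := \sum_w (p w - m w).
have dE : d = \sum_w (q w - m w) by rewrite /d !sumrB pq.
have d0 : 0 <= d by rewrite sumr_ge0.
pose rest w w' := (p w - m w) * (q w' - m w') / d.
have rest0 w w' : 0 <= rest w w'.
  by rewrite /rest mulr_ge0 ?invr_ge0// mulr_ge0.
have restp w : \sum_w' rest w w' = p w - m w.
  rewrite /rest -mulr_suml -mulr_sumr -dE.
  have [dz|dn] := eqVneq d 0; last by rewrite mulfK.
  have /eqP := dz; rewrite psumr_eq0// => /allP/(_ w); rewrite mem_index_enum.
  by move=> /(_ isT)/eqP ->; rewrite !mul0r.
have restq w' : \sum_w rest w w' = q w' - m w'.
  rewrite /rest -mulr_suml -mulr_suml -/d.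
  have [dz|dn] := eqVneq d 0; last by rewrite mulrC mulKf.
  have /eqP := dz; rewrite dE psumr_eq0// => /allP/(_ w'); rewrite mem_index_enum.
  by move=> /(_ isT)/eqP ->; rewrite mulr0 mul0r.
have diag w (f : W -> R) : \sum_w' (w == w')%:R * f w' = f w.
  rewrite (bigD1 w) //= eqxx mul1r big1 ?addr0// => w' ww'.
  by rewrite eq_sym (negbTE ww') mul0r.
exists (fun w w' => (w == w')%:R * m w' + rest w w'); split.
- move=> w w'; rewrite addr_ge0// mulr_ge0//.
  by rewrite /m le_min p0 q0.
- by move=> w; rewrite big_split /= diag restp addrC subrK.
- move=> w'; rewrite big_split /= restq; under eq_bigr do rewrite eq_sym.
  by rewrite (bigD1 w') //= eqxx mul1r big1 ?addr0 ?subrKC// => w ww';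
    rewrite eq_sym (negbTE ww') mul0r.
have -> : \sum_w \sum_w' ((w == w')%:R * m w' + rest w w') * c w w' =
    \sum_w \sum_w' rest w w' * c w w'.
  apply: eq_bigr => w _; apply: eq_bigr => w' _.
  have [<-|ww'] := eqVneq w w'; first by rewrite c0 !mulr0.
  by rewrite mul0r add0r.
apply: (@le_trans _ _ (\sum_w \sum_w' C * rest w w')).
  by apply: ler_sum => w _; apply: ler_sum => w' _; rewrite mulrC ler_wpM2r.
under eq_bigr do rewrite -mulr_sumr restp.
rewrite -mulr_sumr ler_wpM2l//; apply: ler_sum => w _.
rewrite /m minElt; case: ltP => _; first by rewrite subrr.
exact: ler_norm.
Qed.

Lemma transport_refl p : (forall w, 0 <= p w) -> (forall w, c w w = 0) ->
  (exists C, forall w w', c w w' <= C) -> transport c p p 0.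
Proof.
move=> p0 c0 [C cC].
have := @transport_tv p p (Num.max 0 C) p0 p0 erefl c0.
rewrite big1 ?mulr0 => [|w _]; last by rewrite subrr normr0.
by apply; rewrite ?le_max ?lexx// => w w'; rewrite le_max cC orbT.
Qed.

End transport.

(** * Blocks of symbols *)

Definition block {R : realType} n (mu : probability past R)
  (w : n.-tuple bool) : R := prob mu (cylb w).

Definition hamming {R : realType} n (w w' : n.-tuple bool) : R :=
  \sum_(i < n) (tnth w i != tnth w' i)%:R.

Section hamming.
Context {R : realType} (n : nat).
Implicit Types w : n.-tuple bool.

Lemma hamming_triangle w w' w'' :
  hamming w w'' <= hamming w w' + hamming w' w'' :> R.
Proof.
rewrite /hamming -big_split /=; apply: ler_sum => i _.
by case: (tnth w i); case: (tnth w' i); case: (tnth w'' i); rewrite /=; lra.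
Qed.

Lemma hamming_sym w w' : hamming w w' = hamming w' w :> R.
Proof. by apply: eq_bigr => i _; rewrite eq_sym. Qed.

Lemma hammingxx w : hamming w w = 0 :> R.
Proof. by apply: big1 => i _; rewrite eqxx. Qed.

Lemma hamming_le w w' : hamming w w' <= n%:R :> R.
Proof.
rewrite -[n in leRHS]card_ord -sumr_const; apply: ler_sum => i _.
by case: (_ != _).
Qed.

End hamming.

Lemma block_ge0 {R : realType} n (mu : probability past R) (w : n.-tuple bool) :
  0 <= block mu w.
Proof. exact: prob_ge0. Qed.

Lemma block_transport_refl {R : realType} n (mu : probability past R) :
  transport (@hamming R n) (block mu) (block mu) 0.
Proof.
apply: transport_refl; [exact: block_ge0|exact: hammingxx|].
by exists n%:R; exact: hamming_le.
Qed.

Lemma sum_block {R : realType} n (mu : probability past R) (b : past -> bool) :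
  depends n b ->
  \sum_(w : n.-tuple bool) block mu w * (b (pad true w))%:R = prob mu b.
Proof.
move=> db; have [L mL muL] := measure_mean mu.
have dbR : depends n (fun x => (b x)%:R : R) by move=> x y /db ->.
rewrite (muL _ _ db) [in RHS](cyl_decomposition dbR) (mean_sum mL) => [|w].
  apply: eq_bigr => w _; rewrite (meanZ mL); last exact: bdd_bool.
  by rewrite mulrC -(muL _ _ (@depends_cylb w)).
by apply: bddZ; exact: bdd_bool.
Qed.

Lemma sum_block1 {R : realType} n (mu : probability past R) :
  \sum_(w : n.-tuple bool) block mu w = 1.
Proof.
have := sum_block mu (n := n) (b := fun=> true) (fun _ _ _ => erefl).
under eq_bigr do rewrite mulr1; move=> ->.
rewrite /prob (_ : [set x | _] = setT) ?probability_setT//.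
by apply/seteqP; split.
Qed.


(** Restrict a nearly optimal coupling to blocks; by stationarity each of the
    n positions disagrees with the same probability. *)
Lemma dbar_transport {R : realType} n (mu mu' : probability past R) t :
  (dbar mu mu' < t%:E)%E ->
  transport (@hamming R n) (block mu) (block mu') (n%:R * t).
Proof.
move=> /ereal_inf_lt[_ [nu /coupling_mean[L [mL L1 L2 Lshift ->]] <-]].
rewrite lte_fin => Lt.
exists (fun w w' : n.-tuple bool => L (fun q => (cylb w q.1 && cylb w' q.2)%:R)).
have Lsum (f : n.-tuple bool -> past * past -> bool) (b : past * past -> bool) :
    (forall q, \sum_w (f w q)%:R = (b q)%:R :> R) ->
    \sum_w L (fun q => (f w q)%:R) = L (fun q => (b q)%:R).
  move=> fb; rewrite -(mean_sum mL) => [|w]; last exact: bdd_bool.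
  by congr L; apply/funext => q; exact: fb.
split.
- by move=> w w'; exact: mean_bool_ge0.
- move=> w; rewrite (Lsum _ (fun q => cylb w q.1)) => [|q].
    exact: L1 (@depends_cylb w).
  under eq_bigr do rewrite -mulnb natrM.
  by rewrite -mulr_sumr sum_cylb mulr1.
- move=> w'; rewrite (Lsum _ (fun q => cylb w' q.2)) => [|q].
    exact: L2 (@depends_cylb w').
  under eq_bigr do rewrite -mulnb natrM.
  by rewrite -mulr_suml sum_cylb mul1r.
have Lne i : L (fun q => (q.1 i != q.2 i)%:R) = L (fun q => (q.1 0%N != q.2 0%N)%:R).
  elim: i => // i <-.
  apply: (Lshift i.+1 (fun q => q.1 i != q.2 i)) => q r /mkseqP qr1 /mkseqP qr2.
  by rewrite qr1// qr2.
have -> : \sum_(w : n.-tuple bool) \sum_(w' : n.-tuple bool)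
    L (fun q => (cylb w q.1 && cylb w' q.2)%:R) * hamming w w' =
    L (fun q => \sum_(w : n.-tuple bool) \sum_(w' : n.-tuple bool)
      hamming w w' * (cylb w q.1 && cylb w' q.2)%:R).
  rewrite (mean_sum mL) => [|w].
    apply: eq_bigr => w _; rewrite (mean_sum mL) => [|w'].
      apply: eq_bigr => w' _; rewrite (meanZ mL) 1?mulrC//; exact: bdd_bool.
    by apply: bddZ; exact: bdd_bool.
  by apply: bdd_sum => w'; apply: bddZ; exact: bdd_bool.
have -> : (fun q : past * past => \sum_(w : n.-tuple bool) \sum_(w' : n.-tuple bool)
      hamming w w' * (cylb w q.1 && cylb w' q.2)%:R) =
    fun q => \sum_(i < n) (q.1 i != q.2 i)%:R :> R.
  apply/funext => q.
  transitivity (\sum_(w : n.-tuple bool) \sum_(w' : n.-tuple bool)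
      (\sum_(i < n) (q.1 i != q.2 i)%:R) * ((cylb w q.1)%:R * (cylb w' q.2)%:R) : R).
    apply: eq_bigr => w _; apply: eq_bigr => w' _; rewrite -natrM mulnb.
    have [/andP[/eqP w1 /eqP w2]|_] := boolP (cylb w q.1 && cylb w' q.2); last first.
      by rewrite !mulr0.
    congr (_ * _); apply: eq_bigr => i _.
    rewrite !(tnth_nth false) -w1 -w2 !size_tuple !nth_mkseq//.
  under eq_bigr do rewrite -mulr_sumr -mulr_sumr sum_cylb mulr1.
  by rewrite -mulr_sumr sum_cylb mulr1.
rewrite (mean_sum mL) => [|i]; last exact: bdd_bool.
under eq_bigr do rewrite Lne.
by rewrite sumr_const card_ord -[leLHS]mulr_natl ler_wpM2l// ltW.
Qed.

(** * From block couplings to stationary couplings *)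

(** Only the last s - 1 positions i of a block of length n are too late for a
    word of length s to fit. *)
Lemma sum_late n s : (\sum_(i < n) (n < i + s) <= s)%N.
Proof.
rewrite (reindex_inj rev_ord_inj) /=.
have -> : (\sum_(i < n) (n < n - i.+1 + s) = \sum_(i < n) (i.+1 < s))%N.
  apply: eq_bigr => i _; congr nat_of_bool; have := ltn_ord i.
  by move=> lt_in; apply/idP/idP; lia.
suff : (\sum_(i < n) (i.+1 < s) <= minn n s)%N by lia.
elim: n => [|n IH]; first by rewrite big_ord0.
rewrite big_ord_recr /=; move: IH; set S := \sum_(i < n) _.
by case: (ltnP n.+1 s) => /=; lia.
Qed.

Section averaging.
Context {R : realType} (mu mu' : probability past R).
Hypotheses (inv : invariant shift mu) (inv' : invariant shift mu').

Definition shift_operator (F : past * past -> R) (q : past * past) : R :=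
  F (shift2 q).

Lemma shift_operator_markov : markov_operator shift_operator.
Proof. by move=> q; exact: (mean_eval (shift2 q)). Qed.

Lemma iter_shift_operator t F q :
  iter t shift_operator F q = F (iter t shift2 q).
Proof. by elim: t q => //= t IH q; rewrite /shift_operator IH -iterSr. Qed.

Lemma iter_shift2_fst t q : (iter t shift2 q).1 = iter t shift q.1.
Proof. by elim: t => //= t ->. Qed.

Lemma iter_shift2_snd t q : (iter t shift2 q).2 = iter t shift q.2.
Proof. by elim: t => //= t ->. Qed.

Lemma iter_shiftE t (x : past) i : iter t shift x i = x (i + t)%N.
Proof. by elim: t i => [|t IH] i; rewrite ?addn0//= /shift IH addSnnS. Qed.

Lemma depends_iter_shift T m t (b : past -> T) : depends m b ->
  depends (m + t) (fun x => b (iter t shift x)).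
Proof.
move=> db x y /mkseqP xy; apply: db; apply/mkseqP => i im.
by rewrite !iter_shiftE xy// ltn_add2r.
Qed.

Lemma prob_iter_shift (nu : probability past R) t m b : invariant shift nu ->
  depends m b -> prob nu (fun x => b (iter t shift x)) = prob nu b.
Proof.
move=> nuinv db; elim: t => // t <-.
have mb := measurable_depends (depends_iter_shift (t := t) db).
rewrite /prob -(nuinv _ mb); congr (fine (nu _)).
by apply/seteqP; split=> x; rewrite /= -iterSr.
Qed.

Variable cost : R.
Hypothesis blocks : forall n,
  transport (@hamming R n.+1) (block mu) (block mu') (n.+1%:R * cost).

Let plan n : n.+1.-tuple bool -> n.+1.-tuple bool -> R := sval (cid (blocks n)).
Arguments plan : clear implicits.

Let block_mean n (F : past * past -> R) : R :=
  \sum_w \sum_w' plan n w w' * F (pad true w, pad true w').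

Let L (F : past * past -> R) : R :=
  glim (fun n => block_mean n (fun q => cesaro shift_operator q n F)).

Let planP n : [/\ forall w w', 0 <= plan n w w',
    forall w, \sum_w' plan n w w' = block mu w,
    forall w', \sum_w plan n w w' = block mu' w' &
    \sum_w \sum_w' plan n w w' * hamming w w' <= n.+1%:R * cost].
Proof. by rewrite /plan; case: cid. Qed.

Let block_mean_mean n : is_mean (block_mean n).
Proof.
have [pi0 pip _ _] := planP n.
rewrite (_ : block_mean n = fun F => \sum_(u : _ * _) plan n u.1 u.2 *
    F (pad true u.1, pad true u.2)); last first.
  by apply/funext => F; rewrite /block_mean pair_big.
apply: mean_convex => [u|u|]; [exact: mean_eval|exact: pi0|].
rewrite -(pair_big xpredT xpredT (fun w w' => plan n w w')) /=.
by under eq_bigr do rewrite pip; exact: sum_block1.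
Qed.

Let block_mean_fst n (b : past -> bool) : depends n.+1 b ->
  block_mean n (fun q => (b q.1)%:R) = prob mu b.
Proof.
have [_ pip _ _] := planP n; move=> db; rewrite -(sum_block mu db).
by apply: eq_bigr => w _; rewrite /= -mulr_suml pip.
Qed.

Let block_mean_snd n (b : past -> bool) : depends n.+1 b ->
  block_mean n (fun q => (b q.2)%:R) = prob mu' b.
Proof.
have [_ _ piq _] := planP n; move=> db; rewrite -(sum_block mu' db).
by rewrite /block_mean exchange_big /=; apply: eq_bigr => w _; rewrite /= -mulr_suml piq.
Qed.

(** A plan on blocks of length n + 1, averaged over the n + 1 shifts. *)
Let average n (F : past * past -> R) : R :=
  block_mean n (fun q => cesaro shift_operator q n F).

Let average_mean n : is_mean (average n).
Proof.
have cm q := cesaro_mean shift_operator_markov q n.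
split=> [c F G Fb Gb|F Fb F0|].
- rewrite /average (_ : (fun q => _) = fun q => c * cesaro shift_operator q n F +
      cesaro shift_operator q n G); last first.
    by apply/funext => q; case: (cm q) => lin _ _; rewrite lin.
  case: (block_mean_mean n) => -> //.
    by have [B FB] := Fb; exists B => q; exact: (mean_bound (cm q)).
  by have [B GB] := Gb; exists B => q; exact: (mean_bound (cm q)).
- apply: (mean_ge0 (block_mean_mean n)) => [|q].
    by have [B FB] := Fb; exists B => q; exact: (mean_bound (cm q)).
  exact: (mean_ge0 (cm q)).
- rewrite /average (_ : (fun q => _) = fun=> 1).
    by case: (block_mean_mean n).
  by apply/funext => q; case: (cm q).
Qed.

Let LE F : L F = glim (fun n => average n F). Proof. by []. Qed.

Let L_mean : is_mean L.
Proof. exact: mean_glim average_mean. Qed.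

Let average_bdd F : bdd F -> bdd (fun n => average n F).
Proof. by move=> [B FB]; exists B => n; exact: (mean_bound (average_mean n)). Qed.

(** The shift changes an average only by its end terms. *)
Let L_shift F : bdd F -> L (fun q => F (shift2 q)) = L F.
Proof.
move=> Fb; have [B FB] := Fb; rewrite !LE.
apply: (@glim_harmonic _ _ _ (B + B)) => [| |n].
- by apply: average_bdd; exact: bdd_comp.
- exact: average_bdd.
- rewrite -[X in _ <= X](mean_cst (block_mean_mean n)) /average.
  have cb G : bdd G -> bdd (fun q => cesaro shift_operator q n G).
    move=> [C GC]; exists C => q.
    exact: (mean_bound (cesaro_mean shift_operator_markov q n)).
  apply: (mean_dist (block_mean_mean n)) => [| | |q].
  + by apply: cb; exact: bdd_comp.
  + exact: cb.
  + exact: bdd_cst.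
  + exact: (cesaro_invariant shift_operator_markov q n FB).
Qed.

(** The marginal is exact at the times t for which the word read at t ends
    inside the block; the few other times disappear in the limit. *)
Let average_marginal (pr : past * past -> past) (nu : probability past R) m
    (b : past -> bool) :
  (forall t q, pr (iter t shift2 q) = iter t shift (pr q)) ->
  (forall n (c : past -> bool), depends n.+1 c ->
     block_mean n (fun q => (c (pr q))%:R) = prob nu c) ->
  invariant shift nu -> depends m b -> L (fun q => (b (pr q))%:R) = prob nu b.
Proof.
move=> prt prnu nuinv db; rewrite LE -[RHS]glim_cst.
have b01 : 0 <= prob nu b <= 1.
  by rewrite prob_ge0 prob_le1//; exact: measurable_depends db.
apply: (@glim_harmonic _ _ _ m%:R) => [| |n]; [|exact: bdd_cst|].
  by apply: average_bdd; exact: bdd_bool.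
have mB := block_mean_mean n.
pose Bt t := block_mean n (fun q => (b (iter t shift (pr q)))%:R).
have -> : average n (fun q => (b (pr q))%:R) = \sum_(t < n.+1) n.+1%:R^-1 * Bt t.
  rewrite /average /cesaro (mean_sum mB) => [|t]; last first.
    apply: bddZ; rewrite (_ : iter _ _ _ = fun q => (b (iter t shift (pr q)))%:R).
      exact: bdd_bool.
    by apply/funext => q; rewrite iter_shift_operator prt.
  apply: eq_bigr => t _; rewrite -(meanZ mB); last exact: bdd_bool.
  by congr (block_mean n); apply/funext => q; rewrite iter_shift_operator prt.
have -> : prob nu b = \sum_(t < n.+1) n.+1%:R^-1 * prob nu b.
  by rewrite sumr_const card_ord -mulrnAl -[_ *+ n.+1]mulr_natr mulVf ?mul1r// pnatr_eq0.
rewrite -!mulr_sumr -mulrBr normrM ger0_norm// ler_wpM2l//.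
rewrite -sumrB; apply: le_trans (ler_norm_sum _ _ _) _.
apply: (@le_trans _ _ (\sum_(t < n.+1) (n.+1 < t + m)%:R)); last first.
  by rewrite -natr_sum ler_nat sum_late.
apply: ler_sum => t _; case: ltnP => tm.
  have : 0 <= Bt t <= 1 by rewrite (mean_bool_ge0 mB) (mean_bool_le1 mB).
  move: b01; rewrite ler_norml => /andP[? ?] /andP[? ?].
  by apply/andP; split; rewrite /=; lra.
have dbt : depends n.+1 (fun x => b (iter t shift x)).
  by apply: depends_le (depends_iter_shift (t := t) db); rewrite addnC.
by rewrite /Bt (prnu _ _ dbt) (prob_iter_shift t nuinv db) subrr normr0.
Qed.

(** The averaged plans have asymptotically the right marginals and invariance,
    and the cost of a plan divided by its length is the average probability of
    a disagreement. *)
Lemma transport_dbar : (dbar mu mu' <= cost%:E)%E.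
Proof.
have L1 w : L (fun q => (cylb w q.1)%:R) = prob mu (cylb w).
  exact: (average_marginal iter_shift2_fst block_mean_fst inv (@depends_cylb w)).
have L2 w : L (fun q => (cylb w q.2)%:R) = prob mu' (cylb w).
  exact: (average_marginal iter_shift2_snd block_mean_snd inv' (@depends_cylb w)).
apply: le_trans (dbar_le_mean L_mean L1 L2 L_shift) _.
rewrite lee_fin LE -[leRHS]glim_cst; apply: glim_le; [|exact: bdd_cst|].
  by apply: average_bdd; exact: bdd_bool.
apply: nearW => n; have [_ _ _ pit] := planP n.
rewrite -(@ler_pM2l _ n.+1%:R) ?ltr0n//; apply: le_trans pit.
rewrite /average /block_mean mulr_sumr; apply: ler_sum => w _.
rewrite mulr_sumr; apply: ler_sum => w' _.
rewrite mulrCA /cesaro mulr_sumr (_ : \sum_(t < n.+1) _ = hamming w w')//.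
apply: eq_bigr => t _; rewrite mulrA mulfV ?pnatr_eq0// mul1r iter_shift_operator.
rewrite iter_shift2_fst iter_shift2_snd !iter_shiftE !add0n /=.
by rewrite !(tnth_nth true).
Qed.

End averaging.

(** * Chains of couplings *)

(** The infimum in the distance need not be attained; the error e is halved at
    each step of the chain. *)
Lemma dbar_chain {R : realType} n (mu : nat -> probability past R) k :
  (forall j, (k <= j)%N -> dbar (mu j) (mu j.+1) \is a fin_num) ->
  forall m e, 0 < e ->
  transport (@hamming R n) (block (mu k)) (block (mu (k + m)%N))
    (n%:R * \sum_(k <= j < k + m) fine (dbar (mu j) (mu j.+1)) + e).
Proof.
move=> dfin; elim=> [|m IH] e e0.
  rewrite addn0 big_geq// mulr0 add0r.
  exact: transport_le (ltW e0) (block_transport_refl _ _).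
have e20 : 0 < e / 2 by rewrite divr_gt0.
have n1 : 0 < (n.+1%:R : R) by rewrite ltr0n.
(* Division by n + 1 rather than n covers blocks of length 0 as well. *)
have step : (dbar (mu (k + m)%N) (mu (k + m.+1)%N) <
    (fine (dbar (mu (k + m)%N) (mu (k + m.+1)%N)) + e / 2 / n.+1%:R)%:E)%E.
  rewrite EFinD fineK ?lteDl ?lte_fin ?divr_gt0//; rewrite addnS dfin//;
  exact: leq_addr.
have := transport_trans (@hamming_triangle R n) (IH _ e20) (dbar_transport n step).
apply: transport_le; rewrite addnS big_nat_recr ?leq_addr//=.
have : n%:R * (e / 2 / n.+1%:R) <= e / 2.
  rewrite mulrA ler_pdivrMr// mulrC ler_wpM2l ?(ltW e20)//.
  by rewrite ler_nat.
set x := e / 2 / n.+1%:R => nx; rewrite !mulrDr; lra.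
Qed.

Lemma nneseries_partial {R : realType} (d : nat -> \bar R) k :
  (forall j, (0 <= d j)%E) -> (\sum_(k <= j <oo) d j < +oo)%E ->
  (forall j, (k <= j)%N -> d j \is a fin_num) /\
  forall m, \sum_(k <= j < k + m) fine (d j) <= fine (\sum_(k <= j <oo) d j)%E.
Proof.
move=> d0 doo.
have Sfin : (\sum_(k <= j <oo) d j)%E \is a fin_num.
  by rewrite ge0_fin_numE// nneseries_ge0.
have part m : (\sum_(k <= j < m) d j <= \sum_(k <= j <oo) d j)%E.
  exact: nneseries_lim_ge.
have dfin j : (k <= j)%N -> d j \is a fin_num.
  move=> kj; rewrite ge0_fin_numE//; apply: le_lt_trans doo.
  apply: le_trans (part j.+1); rewrite big_nat_recr//= leeDr//.
  by apply: sume_ge0.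
split=> // m; rewrite -lee_fin fineK//; apply: le_trans (part (k + m)%N).
rewrite -sumEFin !big_nat; apply: lee_sum => j /andP[kj _].
by rewrite fineK// dfin.
Qed.

(** The total variation between blocks of fixed length is a finite sum of
    terms that vanish in the limit. *)
Lemma close_blocks {R : realType} n (mu mu' : nat -> probability past R) :
  (forall w, glim (fun j => prob (mu j) (cylb w)) =
             glim (fun j => prob (mu' j) (cylb w))) ->
  forall k e, 0 < e -> exists m,
    transport (@hamming R n) (block (mu (k + m)%N)) (block (mu' (k + m)%N)) e.
Proof.
move=> mumu' k e e0.
pose D j : R := \sum_(w : n.-tuple bool) `|block (mu j) w - block (mu' j) w|.
have mG : is_mean (@glim R).
  split=> [c u v|u|]; [exact: glim_linear|exact: glim_ge0|exact: glim_cst].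
have Db (w : n.-tuple bool) : bdd (fun j => block (mu j) w - block (mu' j) w).
  by apply: bddB; exact: prob_cyl_bdd.
have D0 : glim D = 0.
  rewrite (mean_sum mG) => [|w]; last exact: bdd_norm.
  apply: big1 => w _; rewrite glim_norm// (meanB mG) ?mumu' ?subrr ?normr0//;
  exact: prob_cyl_bdd.
apply: contrapT => far.
have : e <= glim (fun j => n%:R * D j).
  rewrite -[leLHS]glim_cst; apply: glim_le; [exact: bdd_cst| |].
    by apply: bddZ; apply: bdd_sum => w; exact: bdd_norm.
  exists k => // j /= kj; rewrite leNgt; apply/negP => De; apply: far.
  exists (j - k)%N; rewrite subnKC//; apply: transport_le (ltW De) _.
  apply: transport_tv.
  - exact: block_ge0.
  - exact: block_ge0.
  - by rewrite !sum_block1.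
  - exact: hammingxx.
  - exact: hamming_le.
  - exact: ler0n.
rewrite (meanZ mG) ?D0 ?mulr0 ?leNgt ?e0//.
by apply: bdd_sum => w; exact: bdd_norm.
Qed.

(** A chain of block couplings runs along the first sequence up to a late
    index, where the two sequences agree well on blocks because both converge
    to the only g-measure, and back along the second one. *)
Lemma dbar_le_series {R : realType} (g : past -> R) (gj gj' : nat -> past -> R)
    (mu mu' : nat -> probability past R) k :
  regular g -> (forall j, regular (gj j)) -> (forall j, regular (gj' j)) ->
  (forall e, 0 < e -> \forall j \near \oo, forall x, `|gj j x - g x| <= e) ->
  (forall e, 0 < e -> \forall j \near \oo, forall x, `|gj' j x - g x| <= e) ->
  (forall j, g_measure (gj j) (mu j)) -> (forall j, g_measure (gj' j) (mu' j)) ->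
  (forall nu nu' : probability past R,
     g_measure g nu -> g_measure g nu' -> same_measure nu nu') ->
  (dbar (mu k) (mu' k) <= \sum_(k <= j <oo) dbar (mu j) (mu j.+1)
    + \sum_(k <= j <oo) dbar (mu' j) (mu' j.+1))%E.
Proof.
move=> hg hgj hgj' gjg gj'g gmu gmu' uniq.
have [nu [gnu nuE]] := glim_g_measure hg hgj gjg gmu.
have [nu' [gnu' nuE']] := glim_g_measure hg hgj' gj'g gmu'.
have lim_eq w : glim (fun j => prob (mu j) (cylb w)) =
    glim (fun j => prob (mu' j) (cylb w)).
  rewrite -nuE -nuE' /prob; congr fine.
  exact: (uniq nu nu' gnu gnu' _ (measurable_cyl w)).
set S := (\sum_(k <= j <oo) dbar (mu j) (mu j.+1))%E.
set S' := (\sum_(k <= j <oo) dbar (mu' j) (mu' j.+1))%E.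
have S0 : (0 <= S)%E by apply: nneseries_ge0 => *; exact: dbar_ge0.
have S0' : (0 <= S')%E by apply: nneseries_ge0 => *; exact: dbar_ge0.
have [SS|] := ltP (S + S') +oo%E; last by rewrite leye_eq => /eqP ->; rewrite leey.
have Soo : (S < +oo)%E by apply: le_lt_trans SS; rewrite leeDl.
have Soo' : (S' < +oo)%E by apply: le_lt_trans SS; rewrite leeDr.
have [dfin part] := nneseries_partial (fun j => dbar_ge0 (mu j) (mu j.+1)) Soo.
have [dfin' part'] := nneseries_partial (fun j => dbar_ge0 (mu' j) (mu' j.+1)) Soo'.
have -> : (S + S' = (fine S + fine S')%:E)%E.
  by rewrite EFinD !fineK// ge0_fin_numE.
apply/lee_addgt0Pr => e e0; rewrite -EFinD.
apply: transport_dbar => [||n].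
- by case: (gmu k).
- by case: (gmu' k).
have e30 : 0 < e / 3 by rewrite divr_gt0.
have [m close] := close_blocks n.+1 lim_eq k e30.
have there := dbar_chain n.+1 dfin m e30.
have back := transport_sym (@hamming_sym R n.+1) (dbar_chain n.+1 dfin' m e30).
have tri := @hamming_triangle R n.+1.
apply: transport_le (transport_trans tri (transport_trans tri there close) back).
have n1 : 1 <= n.+1%:R :> R by rewrite ler1n.
have := ler_wpM2l (ler0n R n.+1) (part m).
have := ler_wpM2l (ler0n R n.+1) (part' m).
have : e <= n.+1%:R * e by rewrite ler_peMl// ltW.
rewrite -/S -/S' !mulrDr; lra.
Qed.

Lemma uniform_cvgP {R : realType} (gj : nat -> past -> R) (g : past -> R) :
  {uniform, gj @ \oo --> g} ->
  forall e, 0 < e -> \forall j \near \oo, forall x, `|gj j x - g x| <= e.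
Proof.
move=> gjg e e0.
have /gjg : nbhs (g : {uniform past -> R})
    [set h | forall x, `|g x - h x| < e].
  apply/uniform_nbhs; exists [set z : R * R | `|z.1 - z.2| < e]; split.
    by exists e.
  by move=> h gh x; exact: gh.
move=> near; have {}near : \forall j \near \oo, forall x, `|g x - gj j x| < e.
  exact: near.
by apply: filterS near => j gjj x; rewrite distrC ltW.
Qed.

Theorem theorem3 (R : realType) (g : past -> R)
    (hg : regular g) (hattr : attractive g) :
  (exists mu mu' : probability past R,
     [/\ g_measure g mu, g_measure g mu' & ~ same_measure mu mu'])
  <->
  (exists (gj gj' : nat -> past -> R) (mu mu' : nat -> probability past R),
     [/\ forall j, some_markov_kernel (gj j) /\ some_markov_kernel (gj' j),
         {uniform, gj @ \oo --> g},
         {uniform, gj' @ \oo --> g},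
         forall j, g_measure (gj j) (mu j) /\ g_measure (gj' j) (mu' j) &
         exists k : nat,
           (\sum_(k <= j <oo) dbar (mu j) (mu j.+1)
            + \sum_(k <= j <oo) dbar (mu' j) (mu' j.+1)
            < dbar (mu k) (mu' k))%E]).
Proof.
split=> [multiple|[gj [gj' [mu [mu' [markov gjg gj'g gmu [k lt]]]]]]].
- have [mu [mu' [gmu lt]]] := multiple_dbar_gap hg hattr multiple.
  exists (markov_approx g true), (markov_approx g false), mu, mu'; split.
  + by move=> j; split; exact: markov_approx_markov.
  + exact: markov_approx_cvg.
  + exact: markov_approx_cvg.
  + exact: gmu.
  + by exists 0%N.
- apply: contrapT => unique; move: lt; rewrite ltNge => /negP; apply.
  apply: (dbar_le_series k hg _ _ (uniform_cvgP gjg) (uniform_cvgP gj'g)).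
  + by move=> j; have [[? []]] := markov j.
  + by move=> j; have [_ [? []]] := markov j.
  + by move=> j; case: (gmu j).
  + by move=> j; case: (gmu j).
  + move=> nu nu' gnu gnu'; apply: contrapT => nunu'.
    by apply: unique; exists nu, nu'.
Qed.
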